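(* Let $D\subset\mathbb{C}^{m+n}$ be a bounded Reinhardt domain with coordinates $(w_1,\dots,w_m,z_1,\dots,z_n)$, and for $w\in\mathbb{C}^m$ with nonempty slice $D_w$ let $K_w(z)=K_w(z,z)$ be the Bergman kernel function of $D_w$. Assume that $K_w$ depends smoothly on $w$, so that $K(w,z)=K_w(z)$ is a smooth function $K:D\to\mathbb{R}$, and let $D$ be endowed with the generalized Calabi-Yau structure $$\varphi=dw_1\wedge\cdots\wedge dw_m\wedge\exp(\sqrt{-1}\,\Omega),\qquad \Omega=\frac{\sqrt{-1}}{2}\partial\bar\partial\log K.$$ Let $\mu$ be the smooth function on $D$ defined by $$\mu(w_1,\dots,w_m,z_1,\dots,z_n)=-\frac12\sum_{j=1}^n z_j\frac{\partial}{\partial z_j}\bigl(\log K\bigr).$$ Then $\mu$ is a generalized moment map for the $\varphi$-preserving $S^1$-action on $D$ given by $$e^{\sqrt{-1}\theta}\cdot(w_1,\dots,w_m,z_1,\dots,z_n)=(w_1,\dots,w_m,e^{\sqrt{-1}\theta}z_1,\dots,e^{\sqrt{-1}\theta}z_n).$$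
   Context: A bounded Reinhardt domain $D\subset\mathbb{C}^{m+n}$ is a bounded domain invariant under the standard action of the torus $T^{m+n}$ on $\mathbb{C}^{m+n}$. For $w=(w_1,\dots,w_m)\in\mathbb{C}^m$, the slice is $D_w=\{(z_1,\dots,z_{m+n})\in D : z_j=w_j,\ j=1,\dots,m\}$, regarded (when nonempty) as a bounded Reinhardt domain in $\mathbb{C}^n$ via the last $n$ coordinates. The operators $\partial,\bar\partial$ in $\Omega$ are those of $D\subset\mathbb{C}^{m+n}$ (all variables $w,z$). For a real vector space $V$ of dimension $N$, $V\oplus V^*$ (and its complexification) carries the metric $(X+\alpha,Y+\beta)=\frac12(\beta(X)+\alpha(Y))$ and acts on $\wedge^*V^*$ (resp. $\wedge^*V^*\otimes\mathbb{C}$) by $(X+\alpha)\cdot\varphi=\iota_X\varphi+\alpha\wedge\varphi$. For $\varphi\in\wedge^*V^*\otimes\mathbb{C}$ put $E_\varphi=\{X+\alpha\in(V\oplus V^* )\otimes\mathbb{C} : (X+\alpha)\cdot\varphi=0\}$; a nonzero $\varphi$ is a complex pure spinor if $E_\varphi$ is maximal isotropic, i.e. $\dim_{\mathbb{C}}E_\varphi=N$. Put $\langle\varphi,\psi\rangle=(\sigma(\varphi)\wedge\psi)_N$, with $(\cdot)_N$ the degree-$N$ component and $\sigma$ the anti-homomorphism reversing the order of wedge products of 1-forms. A generalized Calabi-Yau structure on a $2d$-dimensional manifold $M$ is a closed complex form $\varphi$ of pure parity (all components of even degree or all of odd degree) such that each $\varphi_p$ is a complex pure spinor and $\langle\varphi,\bar\varphi\rangle\ne0$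 at each point. The form $\varphi$ on $D$ in the claim is such a structure, and the $S^1$-action preserves it. Let a compact Lie group $G$ with Lie algebra $\mathfrak{g}$ act on $(M,\varphi)$ preserving $\varphi$; $\xi_M$ denotes the fundamental vector field of $\xi\in\mathfrak{g}$. A generalized moment map is a smooth $G$-equivariant map $\mu:M\to\mathfrak{g}^*$ such that $\xi_M-\sqrt{-1}\,d\mu^\xi$ lies in $E_\varphi$ for all $\xi\in\mathfrak{g}$, where $\mu^\xi(p)=\mu(p)(\xi)$. Here $G=S^1$, with Lie algebra and its dual identified with $\mathbb{R}$ so that the generator has fundamental vector field $\xi=\sqrt{-1}\sum_{j=1}^n\bigl\{z_j\frac{\partial}{\partial z_j}-\bar z_j\frac{\partial}{\partial\bar z_j}\bigr\}$; a generalized moment map is then a real-valued $S^1$-invariant smooth function $\mu$ with $\xi-\sqrt{-1}\,d\mu\in E_\varphi$. *)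

(* Defs.v *)
From HB Require Import structures.
From mathcomp Require Import all_boot all_order all_algebra.
From mathcomp Require Import complex ring.
From mathcomp Require Import all_classical all_reals all_analysis.

Set Implicit Arguments.
Unset Strict Implicit.
Unset Printing Implicit Defensive.

Import Order.TTheory GRing.Theory Num.Theory.
Import numFieldNormedType.Exports.

Local Open Scope classical_set_scope.
Local Open Scope ring_scope.

(* The bundled alias gives R[i] the topology of a numFieldType: on 'rV[C R]_k,
   [differentiable] then means complex differentiable, and [open],
   [connected], [bounded_set] refer to the usual topology of C^k. *)
Definition C (R : realType) : numClosedFieldType := R[i]%C.

Definition cplx (R : realType) (x y : R) : C R := (x +i* y)%C.
Definition re (R : realType) (z : C R) : R := complex.Re z.
Definition im (R : realType) (z : C R) : R := complex.Im z.
Definition ofR (R : realType) (x : R) : C R := cplx x 0.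
Definition cis (R : realType) (t : R) : C R := cplx (cos t) (sin t).

Lemma cplx_re_im (R : realType) (z : C R) : z = ofR (re z) + 'i * ofR (im z).
Proof.
case: z => x y; apply/eqP; rewrite eq_complex /=.
by rewrite !(mul0r, mulr0, mul1r, add0r, addr0, subr0) !eqxx.
Qed.

Lemma conj_re_im (R : realType) (z : C R) :
  z^* = ofR (re z) - 'i * ofR (im z).
Proof.
case: z => x y; apply/eqP; rewrite eq_complex /=.
by rewrite !(mul0r, mulr0, mul1r, add0r, addr0, subr0, sub0r, oppr0) !eqxx.
Qed.

Lemma im_subJ (R : realType) (z : C R) :
  'i * (2^-1 * (z - z^*)) = ofR (- im z).
Proof.
rewrite conj_re_im {1}[z]cplx_re_im.
have -> : ofR (- im z) = 'i ^+ 2 * ofR (im z).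
  by rewrite sqrCi mulN1r; apply/eqP; rewrite eq_complex /= oppr0 !eqxx.
by field.
Qed.

Lemma re_addJ (R : realType) (z : C R) :
  'i * (2^-1 * (- ('i * (z + z^*)))) = ofR (re z).
Proof.
rewrite conj_re_im {1}[z]cplx_re_im.
transitivity (- 'i ^+ 2 * ofR (re z)); first by field.
by rewrite sqrCi opprK mul1r.
Qed.

Lemma derive1_rot_re (R : realType) (a b : R) :
  derive1 (fun t : R => cos t * a - sin t * b : R) 0 = - b.
Proof.
rewrite derive1E deriveB; [|exact: derivableM|exact: derivableM].
rewrite !deriveM// !derive_val cos0 sin0 !scaler0 !add0r.
by rewrite oppr0 scaler0 sub0r /GRing.scale/= mulr1.
Qed.

Lemma derive1_rot_im (R : realType) (a b : R) :
  derive1 (fun t : R => cos t * b + sin t * a : R) 0 = a.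
Proof.
rewrite derive1E deriveD; [|exact: derivableM|exact: derivableM].
rewrite !deriveM// !derive_val cos0 sin0 !scaler0 !add0r.
by rewrite oppr0 scaler0 add0r /GRing.scale/= mulr1.
Qed.

(* The library's sigma-finiteness instance on [m1 \x m2] is shadowed by its
   instance for subprobabilities; the alias makes it available again. *)
Section ProductMeasure.
Context d1 d2 (T1 : measurableType d1) (T2 : measurableType d2) (R : realType).
Variable m1 : {sigma_finite_measure set T1 -> \bar R}.
Variable m2 : {sigma_finite_measure set T2 -> \bar R}.

Definition prod_measure : set (T1 * T2)%type -> \bar R := (m1 \x m2)%E.

HB.instance Definition _ := Measure.on prod_measure.

Lemma prod_measure_sigma_finite : sigma_finite setT prod_measure.
Proof.
have /sigma_finiteP[F [TF ndF Foo]] := sigma_finiteT m1.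
have /sigma_finiteP[G [TG ndG Goo]] := sigma_finiteT m2.
exists (fun n => F n `*` G n).
  rewrite -setXTT TF TG predeqE => -[x y]; split.
    move=> [/= [n _ Fnx] [k _ Gky]]; exists (maxn n k) => //; split.
    - by move: x Fnx; exact/subsetPset/ndF/leq_maxl.
    - by move: y Gky; exact/subsetPset/ndG/leq_maxr.
  by move=> [n _ []/= ? ?]; split; exists n.
move=> k; have [? ?] := Foo k; have [? ?] := Goo k.
split; first exact: measurableX.
by rewrite /prod_measure product_measure1E// lte_mul_pinfty// ge0_fin_numE.
Qed.

HB.instance Definition _ := Measure_isSigmaFinite.Build _ _ _ prod_measure
  prod_measure_sigma_finite.

End ProductMeasure.

Section TupleMeasure.
Context d (T : measurableType d) (R : realType).
Variable mu : {sigma_finite_measure set T -> \bar R}.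

Definition cons_pair n (p : T * n.-tuple T) : n.+1.-tuple T :=
  [tuple of p.1 :: p.2].

Lemma measurable_cons_pair n : measurable_fun setT (@cons_pair n).
Proof.
by apply: measurable_cons; [exact: measurable_fst|exact: measurable_snd].
Qed.

Section Step.
Variables (n : nat) (nu : {sigma_finite_measure set (n.-tuple T) -> \bar R}).

Definition tuple_measureS : set (n.+1.-tuple T) -> \bar R :=
  pushforward (prod_measure mu nu) (@cons_pair n).

HB.instance Definition _ := Measure.copy tuple_measureS
  (measure_function_pushforward__canonical__measure_function_Measure
     (prod_measure mu nu) (@measurable_cons_pair n)).

Lemma tuple_measureS_sigma_finite : sigma_finite setT tuple_measureS.
Proof.
have [F TF Foo] := sigma_finiteT (prod_measure mu nu).
pose u (t : n.+1.-tuple T) : T * n.-tuple T := (thead t, [tuple of behead t]).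
have uK : cancel (@cons_pair n) u.
  by move=> [x t]; rewrite /u /cons_pair /= theadE; congr pair; apply: val_inj.
have mu_ : measurable_fun setT u.
  apply/measurable_fun_pairP; split.
    by rewrite (_ : _ \o _ = @tnth _ T ^~ ord0)//; exact: measurable_tnth.
  exact: measurable_behead.
exists (fun k => u @^-1` F k).
  by rewrite -preimage_bigcup -TF preimage_setT.
move=> k; have [mF Fk] := Foo k; split.
  by rewrite -[X in measurable X]setTI; exact: mu_.
rewrite /tuple_measureS /pushforward -comp_preimage.
by rewrite (_ : u \o _ = id)//; apply/funext => x /=; rewrite uK.
Qed.

HB.instance Definition _ := Measure_isSigmaFinite.Build _ _ _ tuple_measureS
  tuple_measureS_sigma_finite.

End Step.

Fixpoint tuple_measure n : {sigma_finite_measure set (n.-tuple T) -> \bar R} :=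
  match n with
  | 0 => \d_ ([tuple] : 0.-tuple T)
  | n'.+1 => tuple_measureS (tuple_measure n')
  end.

End TupleMeasure.

(* C is identified with R x R, so that lebesgueC n is the 2n-dimensional
   Lebesgue measure on C^n. *)
Definition plane (R : realType) := (measurableTypeR R * measurableTypeR R)%type.

Definition lebesgueC (R : realType) (n : nat) :
    {sigma_finite_measure set (n.-tuple (plane R)) -> \bar R} :=
  tuple_measure (prod_measure (@lebesgue_measure R) (@lebesgue_measure R)) n.

Definition of_plane (R : realType) (n : nat) (x : n.-tuple (plane R)) :
    'rV[C R]_n :=
  \row_j cplx (tnth x j).1 (tnth x j).2.

Definition integralC (R : realType) (n : nat) (U : set 'rV[C R]_n)
    (F : 'rV[C R]_n -> C R) : C R :=
  let mu := lebesgueC R n in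
  cplx (\int[mu]_(x in @of_plane R n @^-1` U) re (F (of_plane x)))
       (\int[mu]_(x in @of_plane R n @^-1` U) im (F (of_plane x))).

Definition holomorphic (R : realType) (n : nat) (U : set 'rV[C R]_n)
    (f : 'rV[C R]_n -> C R) : Prop :=
  forall z, U z -> differentiable f z.

Definition bergman_space (R : realType) (n : nat) (U : set 'rV[C R]_n) :
    set ('rV[C R]_n -> C R) :=
  [set f | holomorphic U f /\
    (\int[lebesgueC R n]_(x in @of_plane R n @^-1` U)
       (re (`|f (of_plane x)| ^+ 2))%:E < +oo)%E].

(* The reproducing property determines K on U x U; its values outside are
   irrelevant. *)
Definition is_bergman_kernel (R : realType) (n : nat) (U : set 'rV[C R]_n)
    (K : 'rV[C R]_n -> 'rV[C R]_n -> C R) : Prop :=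
  forall zeta, U zeta ->
    bergman_space U (K^~ zeta) /\
    forall f, bergman_space U f ->
      f zeta = integralC U (fun z => f z * (K z zeta)^*).

Definition bounded_reinhardt_domain (R : realType) (k : nat)
    (D : set 'rV[C R]_k) : Prop :=
  [/\ D !=set0, open D, connected D, bounded_set D &
      forall (t : 'I_k -> R) p, D p -> D (\row_j (cis (t j) * p ord0 j))].

Definition slice (R : realType) (m n : nat) (D : set 'rV[C R]_(m + n))
    (w : 'rV[C R]_m) : set 'rV[C R]_n :=
  [set z | D (row_mx w z)].

(* The real coordinates of C^k are indexed by 'I_(k + k), in the order
   x_1, ..., x_k, y_1, ..., y_k. *)
Definition real_dir (R : realType) (k : nat) (i : 'I_(k + k)) : 'rV[C R]_k :=
  match fintype.split i with
  | inl a => delta_mx ord0 a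
  | inr a => 'i *: delta_mx ord0 a
  end.

Definition real_coord (R : realType) (k : nat) (i : 'I_(k + k))
    (p : 'rV[C R]_k) : R :=
  match fintype.split i with
  | inl a => re (p ord0 a)
  | inr a => im (p ord0 a)
  end.

Definition along (R : realType) (k : nat) (i : 'I_(k + k)) (p : 'rV[C R]_k)
    (t : R) : 'rV[C R]_k :=
  p + ofR t *: real_dir R i.

Definition pderivable (R : realType) (k : nat) (i : 'I_(k + k))
    (f : 'rV[C R]_k -> C R) (p : 'rV[C R]_k) : Prop :=
  @derivable R R R (fun t : R => re (f (along i p t)) : R) 0 1 /\
  @derivable R R R (fun t : R => im (f (along i p t)) : R) 0 1.

Definition pderiv (R : realType) (k : nat) (i : 'I_(k + k))
    (f : 'rV[C R]_k -> C R) (p : 'rV[C R]_k) : C R :=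
  cplx (derive1 (fun t : R => re (f (along i p t)) : R) 0)
       (derive1 (fun t : R => im (f (along i p t)) : R) 0).

Fixpoint Cr_on (R : realType) (k r : nat) (D : set 'rV[C R]_k)
    (f : 'rV[C R]_k -> C R) : Prop :=
  (forall p, D p -> {for p, continuous f}) /\
  match r with
  | 0 => True
  | r'.+1 => forall i : 'I_(k + k),
      (forall p, D p -> pderivable i f p) /\ Cr_on r' D (pderiv i f)
  end.

Definition smooth_on (R : realType) (k : nat) (D : set 'rV[C R]_k)
    (f : 'rV[C R]_k -> C R) : Prop :=
  forall r, Cr_on r D f.

Definition wirt (R : realType) (k : nat) (a : 'I_k)
    (f : 'rV[C R]_k -> C R) (p : 'rV[C R]_k) : C R :=
  2^-1 * (pderiv (lshift k a) f p - 'i * pderiv (rshift k a) f p).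

Definition wirt_bar (R : realType) (k : nat) (a : 'I_k)
    (f : 'rV[C R]_k -> C R) (p : 'rV[C R]_k) : C R :=
  2^-1 * (pderiv (lshift k a) f p + 'i * pderiv (rshift k a) f p).

(* The complexified exterior algebra of the dual of R^N: [phi S] is the
   coefficient of e^{s_1} /\ ... /\ e^{s_q}, where s_1 < ... < s_q are the
   elements of S. *)
Definition ext (R : realType) (N : nat) := {ffun {set 'I_N} -> C R}.

Section Exterior.
Variables (R : realType) (N : nat).
Implicit Types (phi psi : ext R N) (A B S : {set 'I_N}).
Implicit Types (X alpha : 'rV[C R]_N).

Definition inversions A B : nat :=
  #|[set p in finset.setX A B | (p.2 < p.1)%N]%SET|.

Definition ext_scalar (c : C R) : ext R N :=
  [ffun S : {set 'I_N} => if S == finset.set0 then c else 0].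

Definition ext_covector alpha : ext R N :=
  [ffun S : {set 'I_N} => \sum_(i | S == [set i]%SET) alpha ord0 i].

Definition wedge phi psi : ext R N :=
  [ffun S : {set 'I_N} => \sum_(A : {set 'I_N} | A \subset S)
     (-1) ^+ inversions A (S :\: A)%SET * phi A * psi (S :\: A)%SET].

Definition contract X phi : ext R N :=
  [ffun S : {set 'I_N} => \sum_(i | i \notin S)
     (-1) ^+ #|[set j in S | (j < i)%N]%SET| * X ord0 i * phi (i |: S)%SET].

(* The exponential of a form without component of degree 0: its powers of
   exponent greater than N vanish. *)
Definition ext_exp phi : ext R N :=
  \sum_(q < N.+1) (q`!%:R)^-1 *: iter q (wedge phi) (ext_scalar 1).

Definition ext_conj phi : ext R N := [ffun S : {set 'I_N} => (phi S)^*].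

(* Reversing a product of q covectors is a permutation of sign (-1)^C(q,2). *)
Definition ext_rev phi : ext R N :=
  [ffun S : {set 'I_N} => (-1) ^+ 'C(#|S|, 2) * phi S].

(* The component of degree N, read off in the basis e^1 /\ ... /\ e^N. *)
Definition mukai phi psi : C R := wedge (ext_rev phi) psi [set: 'I_N]%SET.

Definition gen_vector := ('rV[C R]_N * 'rV[C R]_N)%type.

Definition gen_pairing (u v : gen_vector) : C R :=
  2^-1 * \sum_i (v.2 ord0 i * u.1 ord0 i + u.2 ord0 i * v.1 ord0 i).

Definition clifford (u : gen_vector) phi : ext R N :=
  contract u.1 phi + wedge (ext_covector u.2) phi.

Definition annihilator phi : set gen_vector := [set u | clifford u phi = 0].

Definition maximal_isotropic (E : set gen_vector) : Prop :=
  exists U : {vspace gen_vector},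
    [/\ forall u, u \in U <-> E u,
        forall u v, E u -> E v -> gen_pairing u v = 0 &
        \dim U = N].

Definition complex_pure_spinor phi : Prop :=
  phi <> 0 /\ maximal_isotropic (annihilator phi).

End Exterior.

Definition form (R : realType) (k : nat) := 'rV[C R]_k -> ext R (k + k).

Section Forms.
Variables (R : realType) (k : nat).
Implicit Types (D : set 'rV[C R]_k) (phi : form R k) (f : 'rV[C R]_k -> C R).

Definition fun_form f : form R k := fun p => ext_scalar (k + k) (f p).

Definition dcoord (i : 'I_(k + k)) : ext R (k + k) :=
  ext_covector (delta_mx ord0 i).

Definition dz (a : 'I_k) : ext R (k + k) :=
  dcoord (lshift k a) + 'i *: dcoord (rshift k a).

Definition dzbar (a : 'I_k) : ext R (k + k) :=
  dcoord (lshift k a) - 'i *: dcoord (rshift k a).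

Definition dform phi : form R k := fun p =>
  \sum_i wedge (dcoord i)
    [ffun S : {set 'I_(k + k)} => pderiv i (fun q => phi q S) p].

Definition del phi : form R k := fun p =>
  \sum_a wedge (dz a)
    [ffun S : {set 'I_(k + k)} => wirt a (fun q => phi q S) p].

Definition delbar phi : form R k := fun p =>
  \sum_a wedge (dzbar a)
    [ffun S : {set 'I_(k + k)} => wirt_bar a (fun q => phi q S) p].

Definition differential f (p : 'rV[C R]_k) : 'rV[C R]_(k + k) :=
  \row_i pderiv i f p.

(* Substitutes dF_i for the i-th coordinate covector, F_i being the i-th real
   coordinate of F. *)
Definition pullback (F : 'rV[C R]_k -> 'rV[C R]_k) phi : form R k := fun p =>
  \sum_(S : {set 'I_(k + k)}) phi (F p) S *:
    \big[@wedge R (k + k)/ext_scalar (k + k) 1]_(i <- enum S)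
      ext_covector (differential (fun q => ofR (real_coord i (F q))) p).

Definition closed_form_on D phi : Prop :=
  (forall S, smooth_on D (fun p => phi p S)) /\
  forall p, D p -> dform phi p = 0.

Definition pure_parity_on D phi : Prop :=
  exists b : bool, forall p S, D p -> phi p S != 0 -> odd #|S| = b.

Definition generalized_calabi_yau D phi : Prop :=
  [/\ closed_form_on D phi, pure_parity_on D phi,
      forall p, D p -> complex_pure_spinor (phi p) &
      forall p, D p -> mukai (phi p) (ext_conj (phi p)) <> 0].

(* An action of S^1 is given as theta |-> (p |-> e^(i theta) . p). *)
Definition preserves_form D (act : R -> 'rV[C R]_k -> 'rV[C R]_k) phi : Prop :=
  forall theta p, D p -> pullback (act theta) phi p = phi p.

Definition fundamental_field (act : R -> 'rV[C R]_k -> 'rV[C R]_k)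
    (p : 'rV[C R]_k) : 'rV[C R]_(k + k) :=
  \row_i ofR (derive1 (fun theta : R => real_coord i (act theta p) : R) 0).

(* The Lie algebra of S^1 is spanned by one generator, so the condition on
   all its elements reduces to the one on the generator. *)
Definition generalized_moment_map D phi
    (act : R -> 'rV[C R]_k -> 'rV[C R]_k) (mu : 'rV[C R]_k -> C R) : Prop :=
  [/\ forall p, D p -> im (mu p) = 0,
      smooth_on D mu,
      forall theta p, D p -> mu (act theta p) = mu p &
      forall p, D p -> annihilator (phi p)
        (fundamental_field act p, - ('i *: differential mu p))].

Definition vec_dz (a : 'I_k) : 'rV[C R]_(k + k) :=
  2^-1 *: (delta_mx ord0 (lshift k a) - 'i *: delta_mx ord0 (rshift k a)).

Definition vec_dzbar (a : 'I_k) : 'rV[C R]_(k + k) :=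
  2^-1 *: (delta_mx ord0 (lshift k a) + 'i *: delta_mx ord0 (rshift k a)).

End Forms.

Section Bergman.
Variables (R : realType) (m n : nat).
Implicit Types (K : 'rV[C R]_(m + n) -> R) (p : 'rV[C R]_(m + n)).

Definition log_kernel K p : C R := ofR (ln (K p)).

Definition bergman_Omega K : form R (m + n) := fun p =>
  ('i / 2) *: del (delbar (fun_form (log_kernel K))) p.

Definition bergman_spinor K : form R (m + n) := fun p =>
  wedge
    (\big[@wedge R _/ext_scalar _ 1]_(j < m) dz R (lshift n j))
    (ext_exp ('i *: bergman_Omega K p)).

Definition bergman_moment K p : C R :=
  - 2^-1 * \sum_(j < n)
    p ord0 (rshift m j) * wirt (rshift m j) (log_kernel K) p.

Definition rotate_z (theta : R) p : 'rV[C R]_(m + n) :=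
  row_mx (lsubmx p) (cis theta *: rsubmx p).

Lemma fundamental_field_rotate_z p :
  fundamental_field rotate_z p =
  'i *: \sum_(j < n) (p ord0 (rshift m j) *: vec_dz R (rshift m j)
                      - (p ord0 (rshift m j))^* *: vec_dzbar R (rshift m j)).
Proof.
apply/rowP => i; rewrite !mxE summxE.
transitivity ('i * \sum_(j < n) 2^-1 *
    ((p ord0 (rshift m j) - (p ord0 (rshift m j))^*)
       *+ (i == lshift (m + n) (rshift m j))
     - 'i * (p ord0 (rshift m j) + (p ord0 (rshift m j))^*)
       *+ (i == rshift (m + n) (rshift m j)))); last first.
  congr (_ * _); apply: eq_bigr => j _; rewrite !mxE eqxx /=.
  case: (i == lshift _ _); case: (i == rshift _ _); rewrite ?mulr1n ?mulr0n;
    ring.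
have sl k (a : 'I_k) : fintype.split (lshift k a) = inl a.
  exact: (unsplitK (inl a)).
have sr k (a : 'I_k) : fintype.split (rshift k a) = inr a.
  exact: (unsplitK (inr a)).
have E1 (x y : 'I_(m + n)) :
  (lshift (m + n) x == rshift (m + n) y) = false.
  by rewrite eq_lrshift.
have E2 (x y : 'I_(m + n)) :
  (rshift (m + n) x == lshift (m + n) y) = false.
  by rewrite eq_rlshift.
have [a ->|a ->] := split_ordP i; rewrite /real_coord ?sl ?sr;
  have [b ->|b ->] := split_ordP a.
- rewrite (_ : (fun theta => _) = cst (re (p ord0 (lshift n b)))); last first.
    by apply/funext => t; rewrite /rotate_z row_mxEl mxE.
  rewrite derive1_cst big1 ?mulr0// => j _.
  by rewrite E1 eq_lshift eq_lrshift !mulr0n subr0 mulr0.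
- rewrite (bigD1 b)//= big1 => [|j jb]; last first.
    rewrite E1 eq_lshift eq_rshift eq_sym (negbTE jb) !mulr0n.
    by rewrite subr0 mulr0.
  rewrite E1 eqxx mulr0n mulr1n.
  rewrite (_ : (fun theta => _) =
    (fun t => cos t * re (p ord0 (rshift m b))
              - sin t * im (p ord0 (rshift m b)))); last first.
    by apply/funext => t; rewrite /rotate_z row_mxEr !mxE; case: (p _ _).
  by rewrite derive1_rot_re subr0 addr0 im_subJ.
- rewrite (_ : (fun theta => _) = cst (im (p ord0 (lshift n b)))); last first.
    by apply/funext => t; rewrite /rotate_z row_mxEl mxE.
  rewrite derive1_cst big1 ?mulr0// => j _.
  by rewrite E2 eq_rshift eq_lrshift !mulr0n subr0 mulr0.
- rewrite (bigD1 b)//= big1 => [|j jb]; last first.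
    rewrite E2 !eq_rshift eq_sym (negbTE jb) !mulr0n.
    by rewrite subr0 mulr0.
  rewrite E2 eqxx mulr0n mulr1n.
  rewrite (_ : (fun theta => _) =
    (fun t => cos t * im (p ord0 (rshift m b))
              + sin t * re (p ord0 (rshift m b)))); last first.
    by apply/funext => t; rewrite /rotate_z row_mxEr !mxE; case: (p _ _).
  by rewrite derive1_rot_im sub0r addr0 re_addJ.
Qed.

End Bergman.

(* Main.v *)
Require Import Defs.
From HB Require Import structures.
From mathcomp Require Import all_boot all_order all_algebra.
From mathcomp Require Import complex ring lra.
From mathcomp Require Import all_classical all_reals all_analysis.
From mathcomp Require Import measurable_realfun.

Set Implicit Arguments.
Unset Strict Implicit.
Unset Printing Implicit Defensive.

Import Order.TTheory GRing.Theory Num.Theory.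
Import numFieldNormedType.Exports.

Local Open Scope classical_set_scope.
Local Open Scope ring_scope.

(** Write [L = log K] and [xi] for the fundamental field of the action.

    The kernel of a slice satisfies [K_w (z, z) = K_w (T z, T z)] for every
    rotation [T] of the individual coordinates, because [T] preserves Lebesgue
    measure and maps the slice onto itself: reproducing [K_w (., T z) o T] at
    [z] and [K_w (., z) o T^-1] at [T z] gives conjugate integrals
    ([bergman_kernel_diag_rotate]).  The constant [1] is square integrable on a
    bounded slice, so [K_w (z, z) = 0], which makes the integral of
    [|K_w (., z)|^2] vanish, would contradict the reproduction of [1]
    ([bergman_kernel_diag_gt0]).  Hence [L] is a smooth function on [D],
    invariant under the rotation of each coordinate [z_j] separately.

    Differentiating this invariance gives
    [z_j * dL/dz_j = conj z_j * dL/dzbar_j], and each of these numbers is half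
    the derivative of [L] along the ray through [z_j]
    ([rotational_derivative], [coord_wirt]).  So [mu] is real, it is smooth
    since [L] is, and it is invariant since the action permutes these rays
    ([moment_rotate]).  It also has the two expressions
    [mu = - 1/2 sum z_j dL/dz_j = - 1/2 sum conj z_j dL/dzbar_j].  Applying
    [d/dzbar_b] to the first and [d/dz_a] to the second, where the differentiated
    coefficients [z_j], [conj z_j] contribute nothing, and using that mixed
    derivatives commute, one gets the second derivatives of [L] that occur in
    [iota_xi Omega]; the outcome is [iota_xi Omega = d mu]
    ([contract_omega_moment]).

    Finally, contraction is an antiderivation, so
    [iota_xi exp (i Omega) = i d mu /\ exp (i Omega)] ([contract_exp]): the
    generalized vector [xi - i d mu] annihilates [exp (i Omega)].  Clifford
    multiplication by it anticommutes with every [dw_j /\ _] because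
    [dw_j (xi) = 0], so it annihilates [dw_1 /\ ... /\ dw_m /\ exp (i Omega)]
    as well ([clifford_wedge_big], [annihilator_moment]).

    The real analysis behind these steps is elementary: smoothness is given
    through iterated partial derivatives, and the mean value theorem turns it
    into the chain rule along a curve in one complex coordinate
    ([derive_curve]) and the commutation of partial derivatives ([pderivC]). *)

(** * Complex numbers in real and imaginary parts *)

Section ComplexParts.
Variable R : realType.
Implicit Types (x y : R) (z w : C R).

Lemma C_eqP z w : re z = re w -> im z = im w -> z = w.
Proof. by case: z => a b; case: w => c d /= -> ->. Qed.

Lemma reD z w : re (z + w) = re z + re w. Proof. by case: z; case: w. Qed.
Lemma imD z w : im (z + w) = im z + im w. Proof. by case: z; case: w. Qed.
Lemma reN z : re (- z) = - re z. Proof. by case: z. Qed.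
Lemma imN z : im (- z) = - im z. Proof. by case: z. Qed.
Lemma reM z w : re (z * w) = re z * re w - im z * im w.
Proof. by case: z; case: w. Qed.
Lemma imM z w : im (z * w) = re z * im w + im z * re w.
Proof. by case: z; case: w. Qed.
Lemma reJ z : re z^* = re z. Proof. by case: z. Qed.
Lemma imJ z : im z^* = - im z. Proof. by case: z. Qed.
Lemma re_i : re ('i : C R) = 0. Proof. by []. Qed.
Lemma im_i : im ('i : C R) = 1. Proof. by []. Qed.
Lemma re1 : re (1 : C R) = 1. Proof. by []. Qed.
Lemma im1 : im (1 : C R) = 0. Proof. by []. Qed.
Lemma re0 : re (0 : C R) = 0. Proof. by []. Qed.
Lemma im0 : im (0 : C R) = 0. Proof. by []. Qed.

Definition reimE := (reD, imD, reN, imN, reM, imM, reJ, imJ, re_i, im_i, re1, im1, re0, im0).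

Lemma ofRD x y : ofR (x + y) = ofR x + ofR y.
Proof. by apply: C_eqP; rewrite ?reimE /= ?addr0. Qed.
Lemma ofRN x : ofR (- x) = - ofR x.
Proof. by apply: C_eqP; rewrite ?reimE /= ?oppr0. Qed.
Lemma ofRM x y : ofR (x * y) = ofR x * ofR y.
Proof. by apply: C_eqP; rewrite ?reimE /= ?(mulr0, mul0r, addr0, subr0). Qed.
Lemma ofR0 : ofR 0 = 0 :> C R. Proof. by []. Qed.
Lemma ofR1 : ofR 1 = 1 :> C R. Proof. by []. Qed.
Lemma ofR_conj x : (ofR x)^* = ofR x.
Proof. by apply: C_eqP; rewrite ?reimE /= ?oppr0. Qed.
Lemma ofR_inj : injective (@ofR R). Proof. by move=> x y []. Qed.
Lemma ofRV x : ofR x^-1 = (ofR x)^-1.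
Proof.
have [->|x0] := eqVneq x 0; first by rewrite invr0 ofR0 invr0.
have ox0 : ofR x != 0 :> C R by apply: contra x0 => /eqP; rewrite -ofR0 => /ofR_inj ->.
by apply: (mulIf ox0); rewrite mulVf// -ofRM mulVf.
Qed.
Lemma im_eq0 z : im z = 0 -> z = ofR (re z).
Proof. by move=> z0; apply: C_eqP. Qed.

Lemma cis0 : cis 0 = 1 :> C R. Proof. by rewrite /cis cos0 sin0. Qed.
Lemma cisD x y : cis (x + y) = cis x * cis y :> C R.
Proof.
apply: C_eqP; rewrite ?reimE /=; first by rewrite cosD.
by rewrite sinD addrC; congr (_ + _); rewrite mulrC.
Qed.
Lemma cisK x : cis (- x) * cis x = 1 :> C R.
Proof. by rewrite -cisD addNr cis0. Qed.
Lemma norm_cis x : `|cis x| = 1 :> C R.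
Proof. by rewrite /cis [LHS]normc_def /= cos2Dsin2 sqrtr1. Qed.

Lemma re_normC z : re `|z| = Num.sqrt (re z ^+ 2 + im z ^+ 2).
Proof. by rewrite /re [X in complex.Re X]normc_def. Qed.

(** The norm of [C R] takes its values in [C R]; [re `|z|] is the corresponding real number. *)
Lemma normC_ofR z : `|z| = ofR (re `|z|).
Proof. by rewrite re_normC [LHS]normc_def. Qed.

Lemma im_normC z : im `|z| = 0.
Proof. by rewrite normC_ofR. Qed.

Lemma re_norm_sqr z : re (`|z| ^+ 2) = re z ^+ 2 + im z ^+ 2.
Proof.
rewrite expr2 normC_ofR -ofRM re_normC /= -expr2 sqr_sqrtr//.
by rewrite addr_ge0// sqr_ge0.
Qed.

Lemma le_ofR x y : (ofR x <= ofR y) = (x <= y). Proof. exact: lecR. Qed.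
Lemma lt_ofR x y : (ofR x < ofR y) = (x < y). Proof. exact: ltcR. Qed.

Lemma norm_ofR x : `|ofR x| = ofR `|x| :> C R.
Proof. by rewrite normC_ofR re_normC /= expr0n addr0 sqrtr_sqr. Qed.

Lemma norm_re_le z : `|re z| <= re `|z|.
Proof. by rewrite re_normC -sqrtr_sqr ler_sqrt ?lerDl ?addr_ge0 ?sqr_ge0. Qed.

Lemma norm_im_le z : `|im z| <= re `|z|.
Proof. by rewrite re_normC -sqrtr_sqr ler_sqrt ?lerDr ?addr_ge0 ?sqr_ge0. Qed.

End ComplexParts.

(** * The complexified exterior algebra *)

Section ExteriorAlgebra.
Variables (R : realType) (N : nat).
Implicit Types (phi psi chi : ext R N) (A B S T : {set 'I_N}).
Implicit Types (X alpha beta : 'rV[C R]_N) (c : C R).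

Lemma ext_scaleE c phi S : (c *: phi) S = c * phi S.
Proof. by rewrite /GRing.scale /= ffunE. Qed.

Lemma ext_addE phi psi S : (phi + psi) S = phi S + psi S.
Proof. by rewrite ffunE. Qed.

Lemma ext_oppE phi S : (- phi) S = - phi S.
Proof. by rewrite ffunE. Qed.

Lemma inversionsE A B :
  inversions A B = (\sum_(a in A) \sum_(b in B) (b < a))%N.
Proof.
rewrite /inversions -sum1_card pair_big_dep /= big_mkcond /=.
rewrite [RHS]big_mkcond; apply: eq_bigr => -[a b] _.
by rewrite inE /= finset.in_setX /=; case: (a \in A); case: (b \in B); case: (b < a)%N.
Qed.

Lemma inversionsUl A B T : (A :&: B)%SET = finset.set0 ->
  inversions (A :|: B)%SET T = (inversions A T + inversions B T)%N.
Proof.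
move=> /eqP; rewrite finset.setI_eq0 => dAB; rewrite !inversionsE.
by rewrite (eq_bigl _ _ (fun x => finset.in_setU x A B)) bigU.
Qed.

Lemma inversionsUr A B T : (A :&: B)%SET = finset.set0 ->
  inversions T (A :|: B)%SET = (inversions T A + inversions T B)%N.
Proof.
move=> /eqP; rewrite finset.setI_eq0 => dAB; rewrite !inversionsE -big_split.
by apply: eq_bigr => a _; rewrite (eq_bigl _ _ (fun x => finset.in_setU x A B)) bigU.
Qed.

(** Both sides are sums over the decompositions of [S] into three disjoint
    sets, and the signs agree because [inversions] is additive in each
    argument under disjoint unions. *)
Lemma wedgeA phi psi chi : wedge (wedge phi psi) chi = wedge phi (wedge psi chi).
Proof.
apply/ffunP => S; rewrite !ffunE.
under eq_bigr => T _ do rewrite ffunE mulr_sumr mulr_suml.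
rewrite (exchange_big_dep (fun A => A \subset S)) /=; last first.
  by move=> T A TS AT; exact: fintype.subset_trans TS.
apply: eq_bigr => A AS; rewrite ffunE mulr_sumr.
(* On the left the union [T] of the first two sets is the index; it is traded
   for [B = T :\: A], the index on the right. *)
rewrite (reindex_onto (fun B => A :|: B)%SET (fun T => T :\: A)%SET) /=; last first.
  move=> T /andP[_ AT]; apply/setP => x; rewrite !inE.
  by case: (boolP (x \in A)) => // /(fintype.subsetP AT) ->.
apply: eq_big => [B|B].
  rewrite finset.subsetUl andbT finset.subUset AS /= finset.subsetD; congr (_ && _).
  by rewrite finset.setDUl finset.setDv finset.set0U; apply/eqP/finset.setDidPl.
move=> /andP[/andP[ABS _] /eqP BA].
have dAB : (A :&: B)%SET = finset.set0.
  by rewrite -BA; apply/setP => x; rewrite !inE; case: (x \in A).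
rewrite BA finset.setDDl.
have -> : (S :\: A = B :|: (S :\: (A :|: B)))%SET.
  apply/setP => x; move/setP/(_ x): BA; rewrite !inE.
  case: (boolP (x \in A)); case: (boolP (x \in B)) => //= xB xA _.
  by rewrite (fintype.subsetP ABS)// inE xB orbT.
have dAS : (A :&: (S :\: (A :|: B)))%SET = finset.set0.
  apply/setP => x; rewrite !inE.
  by case: (x \in A).
have dBS : (B :&: (S :\: (A :|: B)))%SET = finset.set0.
  apply/setP => x; rewrite !inE.
  by case: (x \in B); rewrite ?orbT.
rewrite inversionsUl// inversionsUr// !exprD.
have shuffle (a b c x y z : C R) : a * b * (c * x * y) * z = c * a * x * (b * y * z).
  by ring.
exact: shuffle.
Qed.

Lemma wedgeDl phi psi chi : wedge (phi + psi) chi = wedge phi chi + wedge psi chi.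
Proof.
apply/ffunP => S; rewrite ext_addE !ffunE -big_split /=; apply: eq_bigr => A _.
by rewrite ext_addE mulrDr mulrDl.
Qed.

Lemma wedgeDr phi psi chi : wedge chi (phi + psi) = wedge chi phi + wedge chi psi.
Proof.
apply/ffunP => S; rewrite ext_addE !ffunE -big_split /=; apply: eq_bigr => A _.
by rewrite ext_addE mulrDr.
Qed.

Lemma wedgeZl c phi psi : wedge (c *: phi) psi = c *: wedge phi psi.
Proof.
apply/ffunP => S; rewrite ext_scaleE !ffunE mulr_sumr; apply: eq_bigr => A _.
by rewrite ext_scaleE (mulrCA _ c) -!mulrA.
Qed.

Lemma wedgeZr c phi psi : wedge psi (c *: phi) = c *: wedge psi phi.
Proof.
apply/ffunP => S; rewrite ext_scaleE !ffunE mulr_sumr; apply: eq_bigr => A _.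
by rewrite ext_scaleE mulrCA.
Qed.

Lemma contractD X phi psi :
  Defs.contract X (phi + psi) = Defs.contract X phi + Defs.contract X psi.
Proof.
apply/ffunP => S; rewrite ext_addE !ffunE -big_split /=; apply: eq_bigr => A _.
by rewrite ext_addE mulrDr.
Qed.

Lemma contractZ X c phi : Defs.contract X (c *: phi) = c *: Defs.contract X phi.
Proof.
apply/ffunP => S; rewrite ext_scaleE !ffunE mulr_sumr; apply: eq_bigr => A _.
by rewrite ext_scaleE mulrCA.
Qed.

Lemma wedge_scalarl c phi : wedge (ext_scalar N c) phi = c *: phi.
Proof.
apply/ffunP => S; rewrite ext_scaleE ffunE (bigD1 finset.set0) ?finset.sub0set//=.
rewrite big1 ?addr0 => [|A /andP[_ A0]]; last first.
  by rewrite ffunE (negbTE A0) mulr0 mul0r.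
by rewrite ffunE eqxx finset.setD0 inversionsE big_set0 expr0 mul1r mulrC.
Qed.

Lemma wedge_scalarr c phi : wedge phi (ext_scalar N c) = c *: phi.
Proof.
apply/ffunP => S; rewrite ext_scaleE ffunE (bigD1 S)//=.
rewrite big1 ?addr0 => [|A /andP[AS AnS]]; last first.
  rewrite ffunE finset.setD_eq0 (_ : S \subset A = false) ?mulr0//.
  by apply/negbTE/negP => SA; move/eqP: AnS; apply; apply/eqP;
     rewrite finset.eqEsubset AS.
rewrite ffunE finset.setDv eqxx inversionsE big1 => [|a _]; last by rewrite big_set0.
by rewrite expr0 mul1r mulrC.
Qed.

(** The sign met when [e^i] is moved to or from its place among the factors
    of [e^S].  It is the only sign in the formulas for the wedge product with a
    covector and for the contraction. *)
Definition isign S (i : 'I_N) : C R := (-1) ^+ #|[set j in S | (j < i)%N]%SET|.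

Lemma isign_sqr S i : isign S i * isign S i = 1.
Proof. by rewrite -expr2 sqrr_sign. Qed.

Lemma isignU1 S i j : j \notin S ->
  isign (j |: S)%SET i = isign S i * (-1) ^+ (j < i)%N.
Proof.
move=> jS; rewrite /isign; have [ji|ij] := boolP (j < i)%N; last first.
  rewrite expr0 mulr1; congr (_ ^+ _); congr #|pred_of_set _|; apply/setP => x.
  by rewrite !inE; case: eqVneq => //= -> ; rewrite (negbTE jS) (negbTE ij).
rewrite -exprD addn1; congr (_ ^+ _).
rewrite (_ : [set x in _ | _]%SET = (j |: [set x in S | (x < i)%N])%SET).
  by rewrite cardsU1 inE (negbTE jS).
by apply/setP => x; rewrite !inE; case: eqVneq => //= ->; rewrite ji.
Qed.

Lemma isignD1 S i j : j \in S ->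
  isign (S :\ j)%SET i = isign S i * (-1) ^+ (j < i)%N.
Proof.
move=> jS; rewrite -[in RHS](finset.setD1K jS) isignU1 ?inE ?eqxx//.
by rewrite -mulrA -expr2 sqrr_sign mulr1.
Qed.

(** Exactly one of [i < j] and [j < i] holds; this is the source of every
    anticommutation below. *)
Lemma isign_swap (i j : 'I_N) : i != j ->
  (-1) ^+ (i < j)%N = - (-1) ^+ (j < i)%N :> C R.
Proof.
move=> ij; case: (ltngtP i j) => [_|_|/ord_inj/eqP]; rewrite ?expr0 ?expr1 ?opprK//.
by rewrite (negbTE ij).
Qed.

Lemma wedge_covectorE alpha psi S :
  wedge (ext_covector alpha) psi S =
  \sum_(i in S) isign S i * alpha ord0 i * psi (S :\ i)%SET.
Proof.
rewrite ffunE.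
under eq_bigr => A _ do rewrite ffunE mulr_sumr mulr_suml.
rewrite (exchange_big_dep (fun i => i \in S)) /=; last first.
  by move=> A i AS /eqP Ai; rewrite -finset.sub1set -Ai.
apply: eq_bigr => i iS.
rewrite (big_pred1 [set i]%SET) => [|A]; last first.
  rewrite /=; case: (eqVneq A [set i]%SET) => [->|]; rewrite ?andbT ?andbF//.
  by rewrite finset.sub1set iS.
congr (_ * _ * _); rewrite /isign; congr (_ ^+ _).
rewrite inversionsE big_set1 -sum1_card big_mkcond /= [RHS]big_mkcond /=.
apply: eq_bigr => j _; rewrite !inE; case: eqVneq => [->|]/=.
  by rewrite ltnn andbF.
by case: (j \in S); case: (j < i)%N.
Qed.

Lemma contractE X psi S :
  Defs.contract X psi S = \sum_(i | i \notin S) isign S i * X ord0 i * psi (i |: S)%SET.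
Proof. by rewrite ffunE. Qed.

Lemma wedge_covectorC alpha beta psi :
  wedge (ext_covector alpha) (wedge (ext_covector beta) psi) =
  - wedge (ext_covector beta) (wedge (ext_covector alpha) psi).
Proof.
apply/ffunP => S; rewrite ext_oppE !wedge_covectorE.
under eq_bigr => i iS do rewrite wedge_covectorE mulr_sumr.
under [in RHS]eq_bigr => i iS do rewrite wedge_covectorE mulr_sumr.
rewrite [in RHS](exchange_big_dep (fun j => j \in S)) /=; last first.
  by move=> i j iS; rewrite !inE => /andP[].
rewrite -sumrN; apply: eq_bigr => i iS; rewrite -sumrN; apply: eq_big => j.
  by rewrite !inE iS andbT andbC eq_sym.
rewrite !inE => /andP[ji jS].
rewrite !isignD1// (isign_swap ji).
have -> : (S :\ j :\ i = S :\ i :\ j)%SET by rewrite !finset.setDDl finset.setUC.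
ring.
Qed.

(** Contraction is an antiderivation: the terms that insert and
    remove the same index add up to the pairing, and the others cancel in
    pairs by [isign_swap]. *)
Lemma contract_wedge_covector X alpha psi :
  Defs.contract X (wedge (ext_covector alpha) psi) =
  (\sum_i alpha ord0 i * X ord0 i) *: psi
  - wedge (ext_covector alpha) (Defs.contract X psi).
Proof.
apply/ffunP => S; rewrite contractE ext_addE ext_oppE ext_scaleE wedge_covectorE.
under eq_bigr => i iS do rewrite wedge_covectorE (bigD1 i) ?setU11//= mulrDr.
rewrite big_split /=.
under [X in _ = _ - X]eq_bigr => j jS do
  rewrite contractE (bigD1 j) ?inE ?eqxx//= mulrDr.
rewrite big_split /= opprD addrA; congr (_ + _).
(* The pairing splits into indices outside [S], which come from the left-hand
   side, and indices in [S], which cancel against the subtracted term. *)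
- rewrite mulr_suml [in RHS](bigID (fun i => i \in S)) /=.
  rewrite [X in _ = X - _]addrC -addrA -[LHS]addr0; congr (_ + _).
    apply: eq_bigr => i iS; rewrite isignU1// ltnn expr0 mulr1 finset.setU1K//.
    by rewrite -[RHS]mul1r -(isign_sqr S i); ring.
  apply/esym/eqP; rewrite subr_eq0; apply/eqP/eq_bigr => i iS.
  rewrite isignD1// ltnn expr0 mulr1 finset.setD1K//.
  by rewrite -[LHS]mul1r -(isign_sqr S i); ring.
- rewrite -sumrN; under eq_bigr => i iS do rewrite mulr_sumr.
  under [RHS]eq_bigr => i iS do rewrite mulr_sumr -sumrN.
  rewrite (exchange_big_dep (fun j => j \in S)) /=; last first.
    by move=> i j iS; rewrite !inE => /andP[/orP[/eqP->|//]]; rewrite eqxx.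
  apply: eq_bigr => j jS; apply: eq_big => i.
    rewrite !inE jS orbT/=; case: (eqVneq i j) => [->|ij]; first by rewrite jS.
    by rewrite /= !andbT.
  move=> /andP[iS ji].
  have ij : i != j by apply: contraNneq iS => ->.
  rewrite isignU1// isignD1// (isign_swap ij).
  have -> : ((i |: S) :\ j = i |: (S :\ j))%SET.
    by apply/setP => x; rewrite !inE; case: (eqVneq x i) => // ->; rewrite ij.
  ring.
Qed.

Lemma wedge0l psi : wedge 0 psi = 0.
Proof. by apply: (addrI (wedge 0 psi)); rewrite -wedgeDl !addr0. Qed.

Lemma wedge0r psi : wedge psi 0 = 0.
Proof. by apply: (addrI (wedge psi 0)); rewrite -wedgeDr !addr0. Qed.

Lemma wedgeNr phi psi : wedge psi (- phi) = - wedge psi phi.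
Proof. by rewrite -scaleN1r wedgeZr scaleN1r. Qed.

Lemma contract0 X : Defs.contract X (0 : ext R N) = 0.
Proof. by apply: (addrI (Defs.contract X (0 : ext R N))); rewrite -contractD !addr0. Qed.

Lemma wedge_suml I (r : seq I) (P : pred I) (F : I -> ext R N) psi :
  wedge (\sum_(i <- r | P i) F i) psi = \sum_(i <- r | P i) wedge (F i) psi.
Proof.
by apply: (big_morph (fun x => wedge x psi) (fun x y => wedgeDl x y psi)); exact: wedge0l.
Qed.

Lemma wedge_sumr I (r : seq I) (P : pred I) (F : I -> ext R N) psi :
  wedge psi (\sum_(i <- r | P i) F i) = \sum_(i <- r | P i) wedge psi (F i).
Proof.
by apply: (big_morph (wedge psi) (fun x y => wedgeDr x y psi)); exact: wedge0r.
Qed.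

Lemma contract_sum I (r : seq I) (P : pred I) (F : I -> ext R N) X :
  Defs.contract X (\sum_(i <- r | P i) F i) = \sum_(i <- r | P i) Defs.contract X (F i).
Proof.
by apply: (big_morph (Defs.contract X) (contractD X)); exact: contract0.
Qed.

Lemma ext_covectorD alpha beta :
  ext_covector (alpha + beta) = ext_covector alpha + ext_covector beta.
Proof.
apply/ffunP => S; rewrite ext_addE !ffunE -big_split /=.
by apply: eq_bigr => i _; rewrite mxE.
Qed.

Lemma ext_covectorZ c alpha : ext_covector (c *: alpha) = c *: ext_covector alpha.
Proof.
apply/ffunP => S; rewrite ext_scaleE !ffunE mulr_sumr.
by apply: eq_bigr => i _; rewrite mxE.
Qed.

Lemma ext_covector_sum I (r : seq I) (P : pred I) (F : I -> 'rV[C R]_N) :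
  ext_covector (\sum_(i <- r | P i) F i) = \sum_(i <- r | P i) ext_covector (F i).
Proof.
apply: (big_morph (@ext_covector R N) ext_covectorD).
by rewrite -(scale0r (0 : 'rV[C R]_N)) ext_covectorZ scale0r.
Qed.

Definition evalv alpha X : C R := \sum_i alpha ord0 i * X ord0 i.

Lemma evalvD alpha beta X : evalv (alpha + beta) X = evalv alpha X + evalv beta X.
Proof. by rewrite /evalv -big_split; apply: eq_bigr => i _; rewrite mxE mulrDl. Qed.

Lemma evalvZ c alpha X : evalv (c *: alpha) X = c * evalv alpha X.
Proof. by rewrite /evalv mulr_sumr; apply: eq_bigr => i _; rewrite mxE mulrA. Qed.

Lemma clifford_wedge (u : gen_vector R N) alpha psi :
  clifford u (wedge (ext_covector alpha) psi) =
  evalv alpha u.1 *: psi - wedge (ext_covector alpha) (clifford u psi).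
Proof.
by rewrite /clifford contract_wedge_covector (wedge_covectorC u.2) wedgeDr opprD addrA.
Qed.

(** Clifford multiplication anticommutes with the wedge products by the
    [a j] up to the pairings with [u.1], which vanish; so the annihilated
    spinors are stable under them. *)
Lemma clifford_wedge_big (u : gen_vector R N) (m : nat) (a : 'I_m -> 'rV[C R]_N) psi :
  (forall j, evalv (a j) u.1 = 0) -> clifford u psi = 0 ->
  clifford u (wedge (\big[@wedge R N/ext_scalar N 1]_(j < m) ext_covector (a j)) psi) = 0.
Proof.
move=> a0 u0; elim/big_rec: _ => [|j W _ IH]; first by rewrite wedge_scalarl scale1r.
by rewrite wedgeA clifford_wedge a0 scale0r IH wedge0r subr0.
Qed.

Definition in_degree (d : nat) phi := forall S, (#|S| < d)%N -> phi S = 0.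

Lemma in_degree_wedge_covector d alpha psi : in_degree d psi ->
  in_degree d.+1 (wedge (ext_covector alpha) psi).
Proof.
move=> hd S hS; rewrite wedge_covectorE big1// => i iS.
by rewrite hd ?mulr0//; move: hS; rewrite (cardsD1 i) iS ltnS.
Qed.

Lemma in_degreeW d d' phi : (d <= d')%N -> in_degree d' phi -> in_degree d phi.
Proof. by move=> dd hd S hS; apply: hd; exact: leq_trans dd. Qed.

(** This truncates the exponential series: its term of order [N] is killed by one
    more covector. *)
Lemma in_degree_overflow phi : in_degree N.+1 phi -> phi = 0.
Proof.
by move=> h; apply/ffunP => S; rewrite h ?ffunE// ltnS -[X in (_ <= X)%N]card_ord max_card.
Qed.

Lemma in_degree_sum I (r : seq I) (P : pred I) (F : I -> ext R N) d :
  (forall i, in_degree d (F i)) -> in_degree d (\sum_(i <- r | P i) F i).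
Proof. by move=> h S hS; rewrite sum_ffunE big1// => i _; exact: h. Qed.

Lemma in_degreeZ c phi d : in_degree d phi -> in_degree d (c *: phi).
Proof. by move=> h S hS; rewrite ext_scaleE h ?mulr0. Qed.

Section ExpContraction.
Variables (I J : finType) (c : I -> J -> C R).
Variables (a : I -> 'rV[C R]_N) (b : J -> 'rV[C R]_N) (X beta : 'rV[C R]_N).

Let omega : ext R N :=
  \sum_i wedge (ext_covector (a i)) (\sum_j c i j *: ext_covector (b j)).

Hypothesis betaE : beta = \sum_i \sum_j
  (c i j *: (evalv (a i) X *: b j - evalv (b j) X *: a i)).

Let omegaE psi : wedge omega psi = \sum_i \sum_j c i j *:
  wedge (ext_covector (a i)) (wedge (ext_covector (b j)) psi).
Proof.
rewrite wedge_suml; apply: eq_bigr => i _; rewrite wedgeA wedge_suml wedge_sumr.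
by apply: eq_bigr => j _; rewrite wedgeZl wedgeZr.
Qed.

(* The contraction of [omega] is [beta], and [omega] is even. *)
Let contract_omega psi : Defs.contract X (wedge omega psi) =
  wedge (ext_covector beta) psi + wedge omega (Defs.contract X psi).
Proof.
rewrite betaE !omegaE contract_sum ext_covector_sum wedge_suml -big_split.
apply: eq_bigr => i _ /=.
rewrite contract_sum ext_covector_sum wedge_suml -big_split.
apply: eq_bigr => j _ /=.
rewrite contractZ !contract_wedge_covector -!/(evalv _ _) ext_covectorZ wedgeZl -scalerDr.
congr (_ *: _); rewrite ext_covectorD -scaleNr !ext_covectorZ wedgeDl !wedgeZl.
by rewrite wedgeDr wedgeNr wedgeZr opprD opprK scaleNr addrA.
Qed.

Let covector_omegaC psi :
  wedge (ext_covector beta) (wedge omega psi) =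
  wedge omega (wedge (ext_covector beta) psi).
Proof.
rewrite !omegaE wedge_sumr; apply: eq_bigr => i _.
rewrite wedge_sumr; apply: eq_bigr => j _.
rewrite wedgeZr; congr (_ *: _).
by rewrite wedge_covectorC (wedge_covectorC beta) wedgeNr opprK.
Qed.

Let P q := iter q (wedge omega) (ext_scalar N 1).

Let contract_scalar d : Defs.contract X (ext_scalar N d) = 0.
Proof.
apply/ffunP => S; rewrite !ffunE big1// => i _.
rewrite ffunE (_ : (i |: S)%SET == finset.set0 = false) ?mulr0//.
by apply/negbTE/set0Pn; exists i; rewrite setU11.
Qed.

Let contract_P q : Defs.contract X (P q.+1) = q.+1%:R *: wedge (ext_covector beta) (P q).
Proof.
elim: q => [|q IH].
  by rewrite /P contract_omega contract_scalar wedge0r addr0 scale1r.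
rewrite {1}/P [iter _ _ _]iterS contract_omega -/(P q.+1) IH wedgeZr -covector_omegaC.
by rewrite [q.+2%:R]mulrS scalerDl scale1r.
Qed.

Let P_degree q : in_degree q (P q).
Proof.
elim: q => [|q IH]; first by move=> S; rewrite ltn0.
rewrite /P iterS -/(P q) omegaE.
do 2 (apply: in_degree_sum => ?); apply: in_degreeZ.
apply: in_degree_wedge_covector; apply: in_degreeW (in_degree_wedge_covector _ IH).
exact: leqnSn.
Qed.

(** The derivation rule for the exponential: contraction maps the power
    [omega^(q+1)] to [(q+1) beta /\ omega^q], so it shifts the series by one
    term; the last term of the shifted series exceeds the top degree. *)
Lemma contract_exp :
  Defs.contract X (ext_exp omega) = wedge (ext_covector beta) (ext_exp omega).
Proof.
rewrite /ext_exp -/P contract_sum wedge_sumr big_ord_recl [RHS]big_ord_recr /=.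
rewrite contractZ contract_scalar scaler0 add0r.
rewrite [X in _ + X](_ : _ = 0) ?addr0; last first.
  rewrite wedgeZr (in_degree_overflow (in_degree_wedge_covector _ (@P_degree N))).
  by rewrite scaler0.
apply: eq_bigr => q _; rewrite contractZ wedgeZr contract_P scalerA; congr (_ *: _).
rewrite factS natrM invfM mulrAC mulVf ?mul1r//.
Qed.

End ExpContraction.

End ExteriorAlgebra.

(** * Integrals under measure preserving bijections *)

Section MeasurePreserving.
Context d (T : measurableType d) (R : realType).

Definition preserves_measure (mu : set T -> \bar R) (f : T -> T) : Prop :=
  measurable_fun setT f /\
  forall A, measurable A -> mu (f @^-1` A) = mu A.

Lemma preserves_measure_comp (mu : set T -> \bar R) f g :
  preserves_measure mu f -> preserves_measure mu g ->
  preserves_measure mu (f \o g).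
Proof.
move=> [mf fmu] [mg gmu]; split; first exact: measurableT_comp.
move=> A mA; rewrite comp_preimage gmu ?fmu//.
by rewrite -[X in measurable X]setTI; exact: mf.
Qed.

Import HBSimple HBNNSimple.

Section comp.
Variables (h : {nnsfun T >-> R}) (g : T -> T).
Hypothesis mg : measurable_fun setT g.

Definition nnsfun_comp_fun : T -> R := h \o g.
Local Notation f := nnsfun_comp_fun.
Let mf : measurable_fun setT f. Proof. exact: measurableT_comp. Qed.
Let ff : finite_set (range f).
Proof.
apply: (sub_finite_set _ (@fimfunP _ _ h)).
by move=> _ [x _ <-]; exists (g x).
Qed.
Let f0 : forall x, 0 <= f x. Proof. by move=> x; exact: fun_ge0. Qed.

Definition nnsfun_comp : {nnsfun T >-> R} := HB.pack_for {nnsfun T >-> R} f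
  (@isMeasurableFun.Build _ _ _ _ f mf)
  (@FiniteImage.Build _ _ f ff) (@isNonNegFun.Build _ _ f f0).

End comp.

Lemma sintegral_comp (mu : {measure set T -> \bar R}) (h : {nnsfun T >-> R}) g :
  preserves_measure mu g -> sintegral mu (h \o g) = sintegral mu h.
Proof.
move=> [mg gmu]; rewrite !sintegralET; apply: eq_fsbigr => x _.
congr (_ * _)%E; rewrite comp_preimage gmu//.
Qed.

(** The integral of a nonnegative function is the supremum of the integrals
    of the simple functions below it, and composition with [f] and [g]
    exchanges the simple functions below [F] and below [F \o f]. *)
Lemma ge0_integral_preserved (mu : {measure set T -> \bar R}) f g
    (F : T -> \bar R) :
  preserves_measure mu f -> preserves_measure mu g -> cancel g f -> cancel f g ->
  (forall x, 0 <= F x)%E ->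
  (\int[mu]_x F (f x) = \int[mu]_x F x)%E.
Proof.
move=> pf pg gK fK F0; rewrite !ge0_integralTE//; apply/eqP.
rewrite eq_le; apply/andP; split; apply: ge_ereal_sup => _ [h /= hF <-].
  apply: ereal_sup_ubound; exists (nnsfun_comp h (proj1 pg)) => /=.
    by move=> x; rewrite -{2}(gK x); exact: hF.
  exact: sintegral_comp.
apply: ereal_sup_ubound; exists (nnsfun_comp h (proj1 pf)) => /=.
  by move=> x; exact: hF.
exact: sintegral_comp.
Qed.

Lemma integral_preserved (mu : {measure set T -> \bar R}) f g (F : T -> \bar R) D :
  preserves_measure mu f -> preserves_measure mu g -> cancel g f -> cancel f g ->
  (\int[mu]_(x in f @^-1` D) F (f x) = \int[mu]_(x in D) F x)%E.
Proof.
move=> pf pg gK fK; rewrite integral_mkcond [RHS]integral_mkcond.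
rewrite (_ : _ \_ (f @^-1` D) = (F \_ D) \o f)%E; last first.
  by apply/funext => x; rewrite /patch /=.
rewrite integralE [RHS]integralE; congr (_ - _)%E.
  rewrite -(@ge0_integral_preserved mu f g (F \_ D)^\+%E pf pg gK fK)//.
  by apply: eq_integral => x _; rewrite !funeposE.
rewrite -(@ge0_integral_preserved mu f g (F \_ D)^\-%E pf pg gK fK)//.
by apply: eq_integral => x _; rewrite !funenegE.
Qed.

(** A larger function has more simple functions below it. *)
Lemma ge0_le_integral_nonmeasurable (mu : {measure set T -> \bar R}) (F G : T -> \bar R) :
  (forall x, 0 <= F x <= G x)%E -> (\int[mu]_x F x <= \int[mu]_x G x)%E.
Proof.
move=> FG; have F0 x : (0 <= F x)%E by have /andP[] := FG x.
have G0 x : (0 <= G x)%E by have /andP[h] := FG x; exact: le_trans.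
rewrite !ge0_integralTE//; apply: ge_ereal_sup => _ [h /= hF <-].
apply: ereal_sup_ubound; exists h => // x; apply: le_trans (hF x) _.
by have /andP[] := FG x.
Qed.

End MeasurePreserving.

(** * Rotations of the plane preserve Lebesgue measure *)

Section Plane.
Variable R : realType.
Local Notation leb := (@lebesgue_measure R).

(** Translation preserves the lengths of intervals, which determine the measure. *)
Lemma lebesgue_measure_translation (a : R) (A : set R) : measurable A ->
  leb ((fun x => x + a) @^-1` A) = leb A.
Proof.
move=> mA; pose f : measurableTypeR R -> measurableTypeR R := fun x => x + a.
have mf : measurable_fun setT f by exact: measurable_funD.
pose nu : {measure set (measurableTypeR R) -> \bar R} :=
  measure_function_pushforward__canonical__measure_function_Measure leb mf.
apply/esym/(lebesgue_measure_unique (mu := nu)) => //= _ [[b c]] _ <-.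
rewrite /pushforward /f.
rewrite (_ : _ @^-1` _ = `](b - a), (c - a)]%classic); last first.
  by apply/seteqP; split => x /=; rewrite !in_itv /= ltrBlDr lerBrDr.
rewrite !lebesgue_measure_itv /= !lte_fin ltrD2r opprB.
by case: ifP => // _; congr (_%:E); ring.
Qed.

Local Notation leb2 := (prod_measure leb leb).

(** A shear translates each section of a set, so Fubini reduces the claim to
    translation invariance on the line. *)
Lemma shear_y_preserves (a : R) :
  preserves_measure leb2 (fun p : plane R => (p.1, p.2 + a * p.1)).
Proof.
split=> [|A mA].
  apply/measurable_fun_pairP; split; first exact: measurable_fst.
  apply: measurable_funD; first exact: measurable_snd.
  by apply: measurable_funM => //; exact: measurable_fst.
rewrite /prod_measure /product_measure1; apply: eq_integral => x _ /=.
rewrite -[RHS](lebesgue_measure_translation (a * x)); last exact: measurable_xsection.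
by congr (leb _); apply/seteqP; split=> y /=; rewrite /xsection /= !inE.
Qed.

Lemma shear_x_preserves (a : R) :
  preserves_measure leb2 (fun p : plane R => (p.1 + a * p.2, p.2)).
Proof.
have mf : measurable_fun setT (fun p : plane R => (p.1 + a * p.2, p.2)).
  apply/measurable_fun_pairP; split; last exact: measurable_snd.
  apply: measurable_funD; first exact: measurable_fst.
  by apply: measurable_funM => //; exact: measurable_snd.
split=> // A mA.
have E B : measurable B -> leb2 B = product_measure2 leb leb B.
  by move=> mB; apply: product_measure_unique => // ? ? ? ?; exact: product_measure2E.
rewrite !E//; last by rewrite -[X in measurable X]setTI; exact: mf.
rewrite /product_measure2; apply: eq_integral => y _ /=.
rewrite -[RHS](lebesgue_measure_translation (a * y)); last exact: measurable_ysection.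
by congr (leb _); apply/seteqP; split=> x /=; rewrite /ysection /= !inE.
Qed.

Definition rot2 (c s : R) (p : plane R) : plane R :=
  (c * p.1 - s * p.2, s * p.1 + c * p.2).

(** A rotation is a product of three shears with parameters [- tan (t/2)],
    [sin t] and [- tan (t/2)].  This fails for the half turn only, which is
    the square of a quarter turn. *)
Lemma rot2_preserves (c s : R) : c ^+ 2 + s ^+ 2 = 1 ->
  preserves_measure leb2 (rot2 c s).
Proof.
move=> cs1; have [c1|c1] := eqVneq (1 + c) 0; last first.
  (* [sin / (1 + cos)] is the tangent of the half angle. *)
  pose t := s / (1 + c).
  have -> : rot2 c s = (fun p : plane R => (p.1 + - t * p.2, p.2)) \o
    ((fun p : plane R => (p.1, p.2 + s * p.1)) \o
     (fun p : plane R => (p.1 + - t * p.2, p.2))).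
    have st : s * t = 1 - c.
      apply: (mulIf c1); rewrite /t mulrA divfK//.
      by transitivity (s ^+ 2); [ring|rewrite -[s ^+ 2](addKr (c ^+ 2)) cs1; ring].
    have tc : t * c = s - t by rewrite -[s](divfK c1) -/t; ring.
    apply/funext => -[x y]; rewrite /rot2 /=; congr pair.
      transitivity (x - (s * t) * x - t * y - (t - s * t * t) * y); last by ring.
      rewrite st; transitivity (c * x - (t * c + t) * y); last by ring.
      by rewrite tc subrK.
    transitivity (s * x + (1 - s * t) * y); last by ring.
    by rewrite st; ring.
  apply: preserves_measure_comp; first exact: shear_x_preserves.
  by apply: preserves_measure_comp; [exact: shear_y_preserves|exact: shear_x_preserves].
have cE : c = -1 by apply/eqP; rewrite -addr_eq0 addrC c1.
have sE : s = 0.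
  by apply/eqP; rewrite -sqrf_eq0; apply/eqP; move: cs1; rewrite cE sqrrN expr1n; lra.
have -> : rot2 c s = rot2 0 1 \o rot2 0 1.
  by apply/funext => -[x y]; rewrite /rot2 cE sE /=; congr pair; ring.
suff : preserves_measure leb2 (rot2 0 1).
  by move=> h; exact: preserves_measure_comp.
have -> : rot2 0 1 = (fun p : plane R => (p.1 + - 1 * p.2, p.2)) \o
    ((fun p : plane R => (p.1, p.2 + 1 * p.1)) \o
     (fun p : plane R => (p.1 + - 1 * p.2, p.2))).
  by apply/funext => -[x y]; rewrite /rot2 /=; congr pair; ring.
apply: preserves_measure_comp; first exact: shear_x_preserves.
by apply: preserves_measure_comp; [exact: shear_y_preserves|exact: shear_x_preserves].
Qed.

End Plane.

(** * Componentwise maps of finite powers of a measure space *)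

Section Tuples.
Context d (T : measurableType d) (R : realType).
Variable mu : {sigma_finite_measure set T -> \bar R}.

Definition tuple_map n (f : 'I_n -> T -> T) (x : n.-tuple T) : n.-tuple T :=
  [tuple f i (tnth x i) | i < n].

Lemma tuple_map_cons n (f : 'I_n.+1 -> T -> T) (p : T * n.-tuple T) :
  tuple_map f (cons_pair p) =
  cons_pair (f ord0 p.1, tuple_map (fun i => f (lift ord0 i)) p.2).
Proof.
apply: eq_from_tnth => i; rewrite tnth_mktuple /cons_pair.
have [j ->|->] := unliftP ord0 i; last by rewrite !tnth0.
by rewrite !tnthS tnth_mktuple.
Qed.

Lemma measurable_tuple_map n (f : 'I_n -> T -> T) :
  (forall i, measurable_fun setT (f i)) -> measurable_fun setT (tuple_map f).
Proof.
move=> mf; apply/measurable_fun_tnthP => i.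
rewrite (_ : _ \o _ = f i \o (@tnth _ T ^~ i)); last first.
  by apply/funext => x /=; rewrite tnth_mktuple.
by apply: measurableT_comp => //; exact: measurable_tnth.
Qed.

Lemma prod_preserves d' (T' : measurableType d')
    (nu : {sigma_finite_measure set T' -> \bar R}) f g :
  preserves_measure mu f -> preserves_measure nu g ->
  preserves_measure (prod_measure mu nu) (fun p => (f p.1, g p.2)).
Proof.
move=> [mf fmu] [mg gnu].
have mh : measurable_fun setT (fun p : T * T' => (f p.1, g p.2)).
  apply/measurable_fun_pairP; split.
    by apply: (measurableT_comp mf); exact: measurable_fst.
  by apply: (measurableT_comp mg); exact: measurable_snd.
split=> // A mA.
pose m' : {measure set (T * T') -> \bar R} :=
  measure_function_pushforward__canonical__measure_function_Measure
    (prod_measure mu nu) mh.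
rewrite [RHS](product_measure_unique (m' := m'))// => B C mB mC.
have mfB : measurable (f @^-1` B) by rewrite -[X in measurable X]setTI; exact: mf.
have mgC : measurable (g @^-1` C) by rewrite -[X in measurable X]setTI; exact: mg.
rewrite -(fmu _ mB) -(gnu _ mC) -(product_measure1E mu nu mfB mgC).
by [].
Qed.

(** By induction on [n]: [tuple_measure] is built as an iterated product. *)
Lemma tuple_map_preserves n (f : 'I_n -> T -> T) :
  (forall i, preserves_measure mu (f i)) ->
  preserves_measure (tuple_measure mu n) (tuple_map f).
Proof.
move=> pf; split; first by apply: measurable_tuple_map => i; case: (pf i).
elim: n f pf => [|n IH] f pf A mA /=.
  congr (\d_ _ _); apply/seteqP; split => x /=; last first.
    by rewrite (tuple0 x) (tuple0 (tuple_map f _)).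
  by rewrite (tuple0 x) (tuple0 (tuple_map f _)).
rewrite /tuple_measureS /pushforward.
pose g (p : T * n.-tuple T) := (f ord0 p.1, tuple_map (fun i => f (lift ord0 i)) p.2).
have pg : preserves_measure (prod_measure mu (tuple_measure mu n)) g.
  apply: prod_preserves => //; split; last exact: IH.
  by apply: measurable_tuple_map => i; case: (pf (lift ord0 i)).
have mcA : measurable (@cons_pair _ T n @^-1` A).
  by rewrite -[X in measurable X]setTI; exact: measurable_cons_pair.
rewrite -[RHS]((proj2 pg) _ mcA); congr (prod_measure _ _ _).
by apply/seteqP; split => p /=; rewrite tuple_map_cons.
Qed.

Definition tuple_cube n (B : set T) : set (n.-tuple T) :=
  [set x | forall i, B (tnth x i)].

Lemma measurable_tuple_cube n (B : set T) : measurable B -> measurable (@tuple_cube n B).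
Proof.
move=> mB.
rewrite (_ : tuple_cube _ = \bigcap_(i in [set: 'I_n]) ((@tnth _ T ^~ i) @^-1` B)).
  apply: fin_bigcap_measurable; first exact: finite_finset.
  by move=> i _; rewrite -[X in measurable X]setTI; exact: measurable_tnth.
by apply/seteqP; split => x /= h i //=; exact: h.
Qed.

(** It bounds the volume of bounded subsets of C^n. *)
Lemma tuple_cube_lty n (B : set T) : measurable B -> (mu B < +oo)%E ->
  (tuple_measure mu n (@tuple_cube n B) < +oo)%E.
Proof.
move=> mB muB; elim: n => [|n IH] /=; first by rewrite diracE ltry.
rewrite /tuple_measureS /pushforward.
rewrite (_ : _ @^-1` _ = B `*` @tuple_cube n B); last first.
  apply/seteqP; split => -[a x] /=.
    by move=> h; split; [have := h ord0|move=> i; have := h (lift ord0 i)];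
      rewrite /cons_pair ?tnth0 ?tnthS.
  move=> [/= Ba h] i; rewrite /cons_pair.
  by have [j ->|->] := unliftP ord0 i; rewrite ?tnth0 ?tnthS.
rewrite /prod_measure product_measure1E//; last exact: measurable_tuple_cube.
by rewrite lte_mul_pinfty// ge0_fin_numE.
Qed.

End Tuples.

(** * Vanishing of square integrals *)

Section SquareIntegral.
Context d (T : measurableType d) (R : realType).
Variable mu : {measure set T -> \bar R}.
Import HBSimple HBNNSimple.

(** A simple function [h] below [G] has [h^2] below [G^2], hence [h^2] has
    integral zero; so [h] vanishes almost everywhere. *)
Lemma ge0_integral_eq0_of_sqr (G : T -> R) : (forall x, 0 <= G x) ->
  (\int[mu]_x (G x ^+ 2)%:E = 0)%E -> (\int[mu]_x (G x)%:E = 0)%E.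
Proof.
move=> G0 iG2; apply/eqP; rewrite eq_le integral_ge0 ?andbT; last first.
  by move=> x _; rewrite lee_fin.
rewrite ge0_integralTE; last by move=> x; rewrite lee_fin.
apply: ge_ereal_sup => _ [h /= hG <-].
have h2 : (\int[mu]_x `|(h x ^+ 2)%:E| = 0)%E.
  apply/eqP; rewrite eq_le integral_ge0 ?andbT; last by move=> x _; exact: abse_ge0.
  rewrite -[leRHS]iG2; apply: ge0_le_integral_nonmeasurable => x.
  rewrite abse_ge0 /= lee_fin ger0_norm ?sqr_ge0//.
  by rewrite ler_sqr ?nnegrE ?fun_ge0// -lee_fin hG.
have mh : measurable_fun setT (fun x => (h x)%:E) by exact/measurable_EFinP.
have mh2 : measurable_fun setT (fun x => (h x ^+ 2)%:E).
  by apply/measurable_EFinP; exact: measurable_funX.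
have /(ae_eq_integral_abs mu measurableT mh2) h20 := h2.
rewrite -(integralT_nnsfun mu).
rewrite (ge0_ae_eq_integral measurableT mh (g := cst 0%E)) ?integral0//.
  by move=> x _; rewrite lee_fin.
by apply: filterS h20 => x /= /(_ I)/eqP; rewrite eqe sqrf_eq0 => /eqP ->.
Qed.

Lemma integral_eq0_of_sqr (G : T -> R) :
  (\int[mu]_x (G x ^+ 2)%:E = 0)%E -> (\int[mu]_x (G x)%:E = 0)%E.
Proof.
move=> iG2.
have bound (H : T -> R) : (forall x, 0 <= H x <= `|G x|) ->
    (\int[mu]_x (H x)%:E = 0)%E.
  move=> HG; apply: ge0_integral_eq0_of_sqr; first by move=> x; case/andP: (HG x).
  apply/eqP; rewrite eq_le integral_ge0 ?andbT; last first.
    by move=> x _; rewrite lee_fin sqr_ge0.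
  rewrite -[leRHS]iG2; apply: ge0_le_integral_nonmeasurable => x.
  rewrite !lee_fin sqr_ge0 /= -[leRHS]real_normK ?num_real//.
  by rewrite ler_sqr ?nnegrE//; case/andP: (HG x).
rewrite integralE.
under eq_integral => x _ do rewrite funeposE -EFin_max.
under [X in (_ - X)%E]eq_integral => x _ do rewrite funenegE -EFin_max.
rewrite !bound ?sube0// => x; rewrite le_max lexx orbT /= ge_max normr_ge0 andbT.
  by rewrite -normrN ler_norm.
exact: ler_norm.
Qed.

End SquareIntegral.

Section IntegralOpposite.
Context d (T : measurableType d) (R : realType).
Variable mu : {measure set T -> \bar R}.

(** The opposite exchanges the positive and negative parts, which negates the
    difference of their integrals, also when both are infinite, as [fine] then
    yields [0]. *)
Lemma RintegralN_total (A : set T) (g : T -> R) :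
  \int[mu]_(x in A) (- g x) = - \int[mu]_(x in A) g x.
Proof.
rewrite /Rintegral [in LHS]integralE [in RHS]integralE.
have -> : (\int[mu]_(x in A) ((fun x => (- g x)%:E)^\+ x) =
           \int[mu]_(x in A) ((fun x => (g x)%:E)^\- x))%E.
  by apply: eq_integral => x _; rewrite funeposE funenegE EFinN.
have -> : (\int[mu]_(x in A) ((fun x => (- g x)%:E)^\- x) =
           \int[mu]_(x in A) ((fun x => (g x)%:E)^\+ x))%E.
  by apply: eq_integral => x _; rewrite funeposE funenegE EFinN oppeK.
by case: (integral _ _ _) => [a||]; case: (integral _ _ _) => [b||] //=;
  rewrite ?oppr0// opprB.
Qed.

End IntegralOpposite.

(** * Rotation invariance and positivity of the Bergman kernel *)

Section Rotation.
Variables (R : realType) (n : nat).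
Implicit Types (t : 'I_n -> R) (z : 'rV[C R]_n) (U : set 'rV[C R]_n).

Definition rotate t z : 'rV[C R]_n := \row_j (cis (t j) * z ord0 j).

Lemma rotateK t z : rotate (fun j => - t j) (rotate t z) = z.
Proof. by apply/rowP => j; rewrite !mxE mulrA cisK mul1r. Qed.

Lemma rotateKV t z : rotate t (rotate (fun j => - t j) z) = z.
Proof. by apply/rowP => j; rewrite !mxE mulrA [cis _ * _]mulrC cisK mul1r. Qed.

Lemma rotate_differentiable t z : differentiable (rotate t) z.
Proof.
pose f := mulmxr (diag_mx (\row_j cis (t j))) : 'rV[C R]_n -> 'rV[C R]_n.
have fE : rotate t = f.
  apply/funext => x; apply/rowP => j; rewrite /f /= mul_mx_diag !mxE mulrC.
  by [].
rewrite fE; apply: linear_differentiable; rewrite -[X in continuous X]fE.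
move=> x s /= /(nbhs_ballP (rotate t x)) [e e0 es].
suff : nbhs x (rotate t @^-1` s) by [].
apply/nbhs_ballP; exists e => //= y [_ xy]; apply: es; split => // i j.
rewrite !mxE /ball /= -mulrBr normrM norm_cis mul1r.
by have := xy i j; rewrite (ord1 i).
Qed.

Lemma of_plane_rotate t (x : n.-tuple (plane R)) :
  of_plane (tuple_map (fun i => rot2 (cos (t i)) (sin (t i))) x) =
  rotate t (of_plane x).
Proof.
apply/rowP => j; rewrite !mxE tnth_mktuple /rot2 /=.
by apply: C_eqP; rewrite ?reimE /=; rewrite // [RHS]addrC.
Qed.

Let T t := (fun x : n.-tuple (plane R) =>
  tuple_map (fun i => rot2 (cos (t i)) (sin (t i))) x).

Let T_preserves t : preserves_measure (lebesgueC R n) (T t).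
Proof. by apply: tuple_map_preserves => i; apply: rot2_preserves; exact: cos2Dsin2. Qed.

Let TK t : cancel (T t) (T (fun j => - t j)).
Proof.
move=> x; apply: eq_from_tnth => i; rewrite /T !tnth_mktuple /rot2 /= cosN sinN.
have cs := cos2Dsin2 (t i); case: (tnth x i) => a b /=; congr pair.
  transitivity ((cos (t i) ^+ 2 + sin (t i) ^+ 2) * a); first by ring.
  by rewrite cs mul1r.
transitivity ((cos (t i) ^+ 2 + sin (t i) ^+ 2) * b); first by ring.
by rewrite cs mul1r.
Qed.

Let TKV t : cancel (T (fun j => - t j)) (T t).
Proof.
by move=> x; rewrite -{1}(_ : (fun j => - - t j) = t) ?TK//; apply/funext => j; rewrite opprK.
Qed.

Lemma integral_rotate t U (F : 'rV[C R]_n -> \bar R) :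
  (forall z, U (rotate t z) <-> U z) ->
  (\int[lebesgueC R n]_(x in @of_plane R n @^-1` U) F (rotate t (of_plane x)) =
   \int[lebesgueC R n]_(x in @of_plane R n @^-1` U) F (of_plane x))%E.
Proof.
move=> Ut; rewrite -[RHS](integral_preserved _ _
  (T_preserves t) (T_preserves _) (TKV t) (TK t)).
rewrite (_ : T t @^-1` _ = @of_plane R n @^-1` U).
  by apply: eq_integral => x _; rewrite of_plane_rotate.
by apply/seteqP; split => x /=; rewrite of_plane_rotate; apply Ut.
Qed.

Lemma integralC_rotate t U (F : 'rV[C R]_n -> C R) :
  (forall z, U (rotate t z) <-> U z) ->
  integralC U (fun z => F (rotate t z)) = integralC U F.
Proof.
move=> Ut; rewrite /integralC /Rintegral.
rewrite (integral_rotate (fun z => (re (F z))%:E) Ut).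
by rewrite (integral_rotate (fun z => (im (F z))%:E) Ut).
Qed.

Lemma integralC_conj U (F : 'rV[C R]_n -> C R) :
  integralC U (fun z => (F z)^*) = (integralC U F)^*.
Proof.
apply: C_eqP; rewrite ?reimE /integralC /=.
  by apply: eq_Rintegral => x _; rewrite reJ.
by rewrite -RintegralN_total; apply: eq_Rintegral => x _; rewrite imJ.
Qed.

Lemma bergman_space_rotate t U f : (forall z, U (rotate t z) <-> U z) ->
  bergman_space U f -> bergman_space U (f \o rotate t).
Proof.
move=> Ut [hf f2]; split.
  move=> z Uz; apply: differentiable_comp; first exact: rotate_differentiable.
  by apply: hf; apply/Ut.
by move: f2; rewrite -(integral_rotate (fun z => (re (`|f z| ^+ 2))%:E) Ut).
Qed.

(** Let [T] be the rotation.  The kernel at [zeta] reproduces the function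
    [K (T z) (T zeta)] and the kernel at [T zeta] reproduces [K (T^-1 z) zeta].
    After the substitution by [T] the two integrands are conjugate. *)
Lemma bergman_kernel_diag_rotate t U (K : 'rV[C R]_n -> 'rV[C R]_n -> C R) zeta :
  (forall z, U (rotate t z) <-> U z) -> is_bergman_kernel U K -> U zeta ->
  K zeta zeta = (K (rotate t zeta) (rotate t zeta))^*.
Proof.
move=> Ut hK Uz; have Utz : U (rotate t zeta) by apply/Ut.
have Ut' z : U (rotate (fun j => - t j) z) <-> U z.
  by rewrite -Ut rotateKV.
have [Kz repr_z] := hK _ Uz; have [Ktz repr_tz] := hK _ Utz.
have := repr_z _ (bergman_space_rotate Ut Ktz) => /= ->.
have := repr_tz _ (bergman_space_rotate Ut' Kz); rewrite /= rotateK => ->.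
rewrite -integralC_conj -[LHS](integralC_rotate _ Ut); congr integralC.
by apply/funext => z; rewrite rotateK; apply: C_eqP; rewrite !reimE; ring.
Qed.

End Rotation.

Section BergmanRotation.
Variables (R : realType) (n : nat).
Implicit Types (t : 'I_n -> R) (z : 'rV[C R]_n) (U : set 'rV[C R]_n).

Lemma bounded_set_coord U : bounded_set U -> exists M : R,
  forall z, U z -> forall j, `|z ord0 j| <= ofR M.
Proof.
move=> [M [Mreal hM]].
have M1 : M < `|M| + 1.
  by rewrite (le_lt_trans (real_ler_norm Mreal))// ltrDl.
exists (re (`|M| + 1)) => z Uz j; rewrite -im_eq0; last by rewrite !reimE im_normC addr0.
have := hM _ M1 _ Uz; apply: le_trans.
have -> : `|z| = mx_norm z by [].
rewrite mx_normE -[leLHS]nngE num_le.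
by apply: (le_bigmax _ _ (ord0, j)).
Qed.

(** A subset of C^n with bounded coordinates lies in a cube of finite
    volume. *)
Lemma bergman_space_cst1 U (M : R) : (forall z, U z -> forall j, `|z ord0 j| <= ofR M) ->
  bergman_space U (cst 1).
Proof.
move=> hM; split; first by move=> z _; exact: differentiable_cst.
pose B := (`[- M, M] `*` `[- M, M])%classic : set (plane R).
have mB : measurable B by apply: measurableX; exact: measurable_itv.
have leb_itv : (@lebesgue_measure R `[(- M)%R, M]%classic < +oo)%E.
  by rewrite lebesgue_measure_itv /=; case: ifP => // _; rewrite -EFinB ltry.
have BB : (prod_measure (@lebesgue_measure R) (@lebesgue_measure R) B < +oo)%E.
  rewrite /prod_measure product_measure1E//.
  by rewrite lte_mul_pinfty// ge0_fin_numE.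
apply: le_lt_trans (tuple_cube_lty n mB BB).
have mcube := @measurable_tuple_cube _ _ n B mB.
rewrite -(setIT (tuple_cube _)) -integral_indic// [leLHS]integral_mkcond.
apply: ge0_le_integral_nonmeasurable => x; rewrite /patch; case: ifPn => [/set_mem Ux|_].
  rewrite re_norm_sqr /cst re1 im1 expr1n expr0n addr0 lee_fin ler01 /= lee_fin.
  rewrite indicE mem_set// => i.
  have := hM _ Ux i; rewrite mxE normC_ofR le_ofR => zi.
  split; rewrite /= in_itv /= -ler_norml; apply: le_trans zi.
    exact: (norm_re_le (cplx _ _)).
  exact: (norm_im_le (cplx _ _)).
by rewrite lexx lee_fin indicE ler0n.
Qed.

(** The diagonal value is the square integral of [K (., zeta)], so it is
    nonnegative.  If it were zero, the integral of [conj (K (., zeta))] would be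
    zero too, but that integral reproduces the value [1] of the constant
    function [1]. *)
Lemma bergman_kernel_diag_gt0 U (K : 'rV[C R]_n -> 'rV[C R]_n -> C R) zeta (k M : R) :
  (forall z, U z -> forall j, `|z ord0 j| <= ofR M) ->
  is_bergman_kernel U K -> U zeta -> K zeta zeta = ofR k -> 0 < k.
Proof.
move=> bU hK Uz Kk; have [[Khol K2] reprK] := hK _ Uz.
pose mu := lebesgueC R n; pose D := @of_plane R n @^-1` U.
set I := integral _ _ _ in K2.
have I0 : (0 <= I)%E.
  by apply: integral_ge0 => x _; rewrite lee_fin re_norm_sqr addr_ge0// sqr_ge0.
have kI : k = fine I.
  have := congr1 (@re R) (reprK _ (conj Khol K2)); rewrite Kk /= => ->.
  by congr fine; apply: eq_integral => x _; rewrite normCK.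
rewrite lt_neqAle kI fine_ge0// andbT eq_sym; apply/negP => /eqP fI0.
have {fI0}I00 : I = 0%E by rewrite -[I]fineK ?ge0_fin_numE// fI0.
have := congr1 (@re R) (reprK _ (bergman_space_cst1 bU)).
rewrite /= => /esym; apply/eqP; rewrite lt_eqF//.
rewrite (_ : Rintegral _ _ _ = 0) ?ltr01// /Rintegral integral_mkcond.
pose G := (fun x => re (K (of_plane x) zeta)) \_ D.
rewrite (_ : integral _ _ _ = \int[mu]_x (G x)%:E)%E; last first.
  apply: eq_integral => x _; rewrite /G /patch.
  by case: ifP => // _; rewrite mul1r reJ.
rewrite integral_eq0_of_sqr//.
apply/eqP; rewrite eq_le integral_ge0 ?andbT; last first.
  by move=> x _; rewrite lee_fin sqr_ge0.
rewrite -[leRHS]I00 /I [leRHS]integral_mkcond.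
apply: ge0_le_integral_nonmeasurable => x; rewrite lee_fin sqr_ge0 /G /patch.
rewrite andTb (_ : (x \in @of_plane R n @^-1` U) = (x \in D))//.
case: ifP => _; last by rewrite lee_fin expr0n.
by rewrite lee_fin re_norm_sqr lerDl sqr_ge0.
Qed.

End BergmanRotation.

(** * Chain rule and equality of mixed derivatives in two real variables *)

Section RealCalculus.
Variable R : realType.
Implicit Types (f g a b : R -> R) (F G : R -> R -> R).

Lemma is_derive1_compose f g (x df dg : R) :
  is_derive x 1 f df -> is_derive (f x) 1 g dg -> is_derive x 1 (g \o f) (dg * df).
Proof.
move=> fd gd.
have fD : derivable f x 1 by exact: ex_derive.
have gD : derivable g (f x) 1 by exact: ex_derive.
have fdiff : differentiable f x by apply/derivable1_diffP.
have gdiff : differentiable g (f x) by apply/derivable1_diffP.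
apply: DeriveDef; first exact/derivable1_diffP/(differentiable_comp fdiff gdiff).
rewrite -derive1E derive1_comp// !derive1E.
by rewrite (@derive_val _ _ _ _ _ _ _ fd) (@derive_val _ _ _ _ _ _ _ gd).
Qed.

Lemma is_derive1_translate f (x df : R) :
  is_derive (0 : R) 1 (fun t => f (x + t)) df -> is_derive x 1 f df.
Proof.
move=> h; have -> : f = (fun t => f (x + t)) \o (fun y => y - x).
  by apply/funext => y /=; rewrite addrC subrK.
rewrite -[df]mulr1; apply: is_derive1_compose; last by rewrite subrr.
by rewrite -[X in is_derive _ _ _ X]subr0; apply: is_deriveB.
Qed.

Lemma is_derive1_translate_eq f g (x df : R) : (forall t, f (x + t) = g t) ->
  is_derive (0 : R) 1 g df -> is_derive x 1 f df.
Proof.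
by move=> fg h; apply: is_derive1_translate; rewrite (_ : (fun t => _) = g)//; exact/funext.
Qed.

Lemma MVT0 f (df : R -> R) (e x : R) : (forall y : R, `|y| < e -> is_derive y 1 f (df y)) ->
  `|x| < e -> exists2 c, `|c| <= `|x| & f x - f 0 = df c * x.
Proof.
move=> fd xe.
have cf y : `|y| <= `|x| -> {for y, continuous f}.
  move=> yx; apply: differentiable_continuous; apply/derivable1_diffP.
  by have := fd y (le_lt_trans yx xe) => ?; exact: ex_derive.
have [x0|x0] := leP 0 x.
  have [||c cx cE] := @MVT_segment R f df 0 x x0.
  - move=> y; rewrite in_itv /= => /andP[y0 yx]; apply: fd.
    by rewrite (lt_trans _ xe)// !ger0_norm// ltW.
  - apply: continuous_in_subspaceT => y /set_mem /=; rewrite in_itv /= => /andP[y0 yx].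
    by apply: cf; rewrite !ger0_norm.
  exists c; last by rewrite cE subr0.
  by move: cx; rewrite in_itv /= => /andP[c0 cx]; rewrite !ger0_norm.
have [||c cx cE] := @MVT_segment R f df x 0 (ltW x0).
- move=> y; rewrite in_itv /= => /andP[y0 yx]; apply: fd.
  by rewrite (lt_trans _ xe)// !ltr0_norm// ltrN2.
- apply: continuous_in_subspaceT => y /set_mem /=; rewrite in_itv /= => /andP[y0 yx].
  by apply: cf; rewrite !ler0_norm// ?lerN2// ltW.
exists c; last by rewrite -[LHS]opprB cE sub0r mulrN opprK.
move: cx; rewrite in_itv /= => /andP[c0 cx].
by rewrite !ler0_norm ?lerN2// ltW.
Qed.

Definition continuous2_at0 F : Prop := forall e : R, 0 < e ->
  exists2 d : R, 0 < d & forall s t, `|s| < d -> `|t| < d -> `|F s t - F 0 0| < e.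

(** Move first in one variable, then in the other.  By the mean value theorem
    each increment is a partial derivative at an intermediate point times the
    increment of the coordinate, and the intermediate points tend to the
    origin. *)
Lemma chain_rule2 F F1 F2 a b (e da db : R) : 0 < e ->
  (forall s t : R, `|s| < e -> `|t| < e -> is_derive s 1 (F^~ t) (F1 s t)) ->
  (forall s t : R, `|s| < e -> `|t| < e -> is_derive t 1 (F s) (F2 s t)) ->
  continuous2_at0 F1 -> continuous2_at0 F2 ->
  a 0 = 0 -> b 0 = 0 -> is_derive (0 : R) 1 a da -> is_derive (0 : R) 1 b db ->
  is_derive (0 : R) 1 (fun t => F (a t) (b t)) (F1 0 0 * da + F2 0 0 * db).
Proof.
move=> e0 dF1 dF2 cF1 cF2 a0 b0 ad bd.
have ca : a @ 0 --> (0 : R).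
  rewrite -[X in _ --> X]a0; apply: differentiable_continuous.
  by apply/derivable1_diffP; exact: ex_derive.
have cb : b @ 0 --> (0 : R).
  rewrite -[X in _ --> X]b0; apply: differentiable_continuous.
  by apply/derivable1_diffP; exact: ex_derive.
(* The intermediate points are chosen for all increments at once, to make them
   functions whose limit can be taken. *)
have /choice[xi xiP] : forall h, exists c : R, `|c| <= `|a h| /\
    (`|a h| < e -> F (a h) 0 - F 0 0 = F1 c 0 * a h).
  move=> h; have [ahe|ahe] := ltP `|a h| e; last by exists 0; rewrite normr0.
  have [|c ch cE] := @MVT0 (F^~ 0) (F1^~ 0) e (a h) _ ahe.
    by move=> y ye; apply: dF1; rewrite ?normr0.
  by exists c.
have /choice[eta etaP] : forall h, exists c : R, `|c| <= `|b h| /\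
    (`|a h| < e -> `|b h| < e -> F (a h) (b h) - F (a h) 0 = F2 (a h) c * b h).
  move=> h; have [ahe|ahe] := ltP `|a h| e; last by exists 0; rewrite normr0.
  have [bhe|bhe] := ltP `|b h| e; last by exists 0; rewrite normr0.
  have [|c ch cE] := @MVT0 (F (a h)) (F2 (a h)) e (b h) _ bhe.
    by move=> y ye; apply: dF2.
  by exists c.
have near_small (u : R -> R) (d : R) : u @ 0 --> (0 : R) -> 0 < d ->
    \forall h \near (0 : R), `|u h| < d.
  move=> u0 d0; have /cvgrPdist_lt /(_ _ d0) := u0.
  by apply: filterS => h; rewrite sub0r normrN.
have lim1 : (fun h => F1 (xi h) 0) @ (0 : R) --> F1 0 0.
  apply/cvgrPdist_lt => r r0; have [d d0 hd] := cF1 _ r0.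
  apply: filterS (near_small _ _ ca d0) => h ah.
  rewrite distrC; apply: hd; rewrite ?normr0//.
  by apply: le_lt_trans ah; have [] := xiP h.
have lim2 : (fun h => F2 (a h) (eta h)) @ (0 : R) --> F2 0 0.
  apply/cvgrPdist_lt => r r0; have [d d0 hd] := cF2 _ r0.
  near=> h; rewrite distrC; apply: hd.
    by near: h; exact: near_small.
  have [bh _] := etaP h; apply: le_lt_trans bh _.
  by near: h; exact: near_small.
have quot (u : R -> R) (du : R) : u 0 = 0 -> is_derive (0 : R) 1 u du ->
    (fun h => h^-1 * u h) @ (0 : R)^' --> du.
  move=> u0 ud; have dv : derivable u 0 1 by exact: ex_derive.
  have <- : 'D_1 u 0 = du by exact: derive_val.
  have := dv; rewrite /derivable /derive => /cvg_ex[l hl].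
  have := hl; rewrite (cvg_lim _ hl)//.
  apply: cvg_trans; apply: near_eq_cvg; near=> h.
  by rewrite u0 subr0 /= [h%:A]mulr1 addr0.
pose Q h := F1 (xi h) 0 * (h^-1 * a h) + F2 (a h) (eta h) * (h^-1 * b h).
have limQ : Q @ (0 : R)^' --> F1 0 0 * da + F2 0 0 * db.
  apply: cvgD; apply: cvgM.
  - exact: cvg_trans (cvg_app _ (@nbhs_dnbhs _ 0)) lim1.
  - exact: quot.
  - exact: cvg_trans (cvg_app _ (@nbhs_dnbhs _ 0)) lim2.
  - exact: quot.
have limG : (fun h => h^-1 *: (F (a (h *: 1 + 0)) (b (h *: 1 + 0)) - F (a 0) (b 0)))
    @ (0 : R)^' --> F1 0 0 * da + F2 0 0 * db.
  apply: cvg_trans limQ; apply: near_eq_cvg; near=> h.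
  rewrite a0 b0 addr0 [h *: 1]mulr1 /Q.
  have ahe : `|a h| < e.
    by near: h; apply: nbhs_dnbhs; exact: near_small.
  have bhe : `|b h| < e.
    by near: h; apply: nbhs_dnbhs; exact: near_small.
  have [_ /(_ ahe) xiE] := xiP h; have [_ /(_ ahe bhe) etaE] := etaP h.
  rewrite mulrCA -xiE [X in _ + X]mulrCA -etaE -mulrDr.
  by rewrite [RHS]/(_ * _); congr (_ * _); ring.
apply: DeriveDef; last exact: cvg_lim limG.
by apply/cvg_ex; exists (F1 0 0 * da + F2 0 0 * db).
Unshelve. all: by end_near.
Qed.

(** The second difference of [F] over a small square is, by the mean value
    theorem applied in the two orders, the area times a value of either mixed
    derivative inside the square. *)
Lemma clairaut F F1 F2 (F12 F21 : R -> R -> R) (e : R) : 0 < e ->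
  (forall s t : R, `|s| < e -> `|t| < e -> is_derive s 1 (F^~ t) (F1 s t)) ->
  (forall s t : R, `|s| < e -> `|t| < e -> is_derive t 1 (F s) (F2 s t)) ->
  (forall s t : R, `|s| < e -> `|t| < e -> is_derive t 1 (F1 s) (F12 s t)) ->
  (forall s t : R, `|s| < e -> `|t| < e -> is_derive s 1 (F2^~ t) (F21 s t)) ->
  continuous2_at0 F12 -> continuous2_at0 F21 -> F12 0 0 = F21 0 0.
Proof.
move=> e0 d1 d2 d12 d21 c12 c21.
apply/eqP; rewrite -subr_eq0 -normr_le0 leNgt; apply/negP.
set r := `|_| => r0.
have r20 : 0 < r / 2 by rewrite divr_gt0.
have [a a0 ha] := c12 _ r20; have [b b0 hb] := c21 _ r20.
(* The side of the square is so small that it stays in the domain and both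
   mixed derivatives vary by less than [r / 2] on it. *)
pose h := Num.min e (Num.min a b) / 2.
have m0 : 0 < Num.min e (Num.min a b) by rewrite !lt_min e0 a0 b0.
have h0 : 0 < h by rewrite divr_gt0.
have hm : h < Num.min e (Num.min a b) by rewrite ltr_pdivrMr// ltr_pMr// ltr1n.
have [he ha' hb'] : [/\ h < e, h < a & h < b].
  by move: hm; rewrite !lt_min => /andP[-> /andP[-> ->]].
have nh : `|h| = h by rewrite gtr0_norm.
have he' : `|h| < e by rewrite nh.
have [s1 s1h E1] := @MVT0 (fun s => F s h - F s 0) (fun s => F1 s h - F1 s 0) e h
  (fun y ye => is_deriveB (d1 y h ye he') (d1 y 0 ye ltac:(by rewrite normr0))) he'.
have s1e : `|s1| < e by exact: le_lt_trans he'.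
have [t1 t1h E2] := @MVT0 (F1 s1) (F12 s1) e h (fun y ye => d12 s1 y s1e ye) he'.
have [t2 t2h E3] := @MVT0 (fun t => F h t - F 0 t) (fun t => F2 h t - F2 0 t) e h
  (fun y ye => is_deriveB (d2 h y he' ye) (d2 0 y ltac:(by rewrite normr0) ye)) he'.
have t2e : `|t2| < e by exact: le_lt_trans he'.
have [s2 s2h E4] := @MVT0 (F2^~ t2) (F21^~ t2) e h (fun y ye => d21 y t2 ye t2e) he'.
have EE : F12 s1 t1 = F21 s2 t2.
  apply: (mulIf (lt0r_neq0 h0)); apply: (mulIf (lt0r_neq0 h0)).
  by rewrite -E2 -E1 -E4 -E3; ring.
have l1 : `|F12 s1 t1 - F12 0 0| < r / 2.
  by apply: ha; rewrite (le_lt_trans _ ha')// -nh.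
have l2 : `|F21 s2 t2 - F21 0 0| < r / 2.
  by apply: hb; rewrite (le_lt_trans _ hb')// -nh.
suff : `|F12 0 0 - F21 0 0| < r / 2 + r / 2 by rewrite -splitr ltxx.
rewrite (_ : F12 0 0 - F21 0 0 = - (F12 s1 t1 - F12 0 0) + (F21 s2 t2 - F21 0 0)).
  by rewrite (le_lt_trans (ler_normD _ _))// normrN ltrD.
by rewrite EE; ring.
Qed.

End RealCalculus.

(** * Partial derivatives along the real coordinates of C^k *)

Section ComplexLimits.
Variables (R : realType).

Lemma cvg_re (T : Type) (F : set_system T) {FF : Filter F} (f : T -> C R) (l : C R) :
  f @ F --> l -> (fun x => re (f x)) @ F --> re l.
Proof.
move=> /cvgrPdist_lt fl; apply/cvgrPdist_lt => e e0.
have := fl (ofR e); rewrite -[X in X < _]ofR0 lt_ofR => /(_ e0).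
apply: filterS => x; rewrite normC_ofR lt_ofR; apply: le_lt_trans.
by rewrite -reN -reD; exact: norm_re_le.
Qed.

Lemma cvg_ofR (T : Type) (F : set_system T) {FF : Filter F} (f : T -> R) (l : R) :
  f @ F --> l -> (fun x => ofR (f x)) @ F --> (ofR l : C R).
Proof.
move=> /cvgrPdist_lt fl; apply/cvgrPdist_lt => e e0.
have eE : e = ofR (re e) by rewrite -im_eq0//; exact: ger0_Im (ltW e0).
have := fl (re e); rewrite -lt_ofR ofR0 -eE => /(_ e0).
by apply: filterS => x; rewrite -ofRN -ofRD norm_ofR eE lt_ofR.
Qed.

Variable k : nat.
Implicit Types (D : set 'rV[C R]_k) (p q : 'rV[C R]_k) (f : 'rV[C R]_k -> C R).

(** Neighbourhoods in [C^k] are measured here by real radii, coordinate by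
    coordinate, which links them to the real curves used for derivatives. *)
Lemma nbhs_box p (A : set 'rV[C R]_k) : nbhs p A ->
  exists2 e : R, 0 < e & forall q, (forall j, re `|q ord0 j - p ord0 j| < e) -> A q.
Proof.
move=> /nbhs_ballP[e /= e0 eA].
have eE : e = ofR (re e) by rewrite -im_eq0//; exact: ger0_Im (ltW e0).
exists (re e); first by rewrite -lt_ofR -eE ofR0.
move=> q qp; apply: eA; split=> // i j.
by rewrite (ord1 i) /ball /= distrC normC_ofR eE lt_ofR; exact: qp.
Qed.

Lemma continuous_box f p : {for p, continuous f} -> forall e : R, 0 < e ->
  exists2 d : R, 0 < d & forall q, (forall j, re `|q ord0 j - p ord0 j| < d) ->
    re `|f q - f p| < e.
Proof.
move=> /cvgrPdist_lt cf e e0; apply: nbhs_box.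
have := cf (ofR e); rewrite -[X in X < _]ofR0 lt_ofR => /(_ e0).
by apply: filterS => q; rewrite distrC normC_ofR lt_ofR.
Qed.

Lemma real_dir_lshift (a : 'I_k) : real_dir R (lshift k a) = delta_mx ord0 a.
Proof. by rewrite /real_dir (unsplitK (inl a)). Qed.

Lemma real_dir_rshift (a : 'I_k) : real_dir R (rshift k a) = 'i *: delta_mx ord0 a.
Proof. by rewrite /real_dir (unsplitK (inr a)). Qed.

Lemma real_dir_norm (i : 'I_(k + k)) j : re `|real_dir R i ord0 j| <= 1.
Proof.
have d (a : 'I_k) : re `|(delta_mx ord0 a : 'rV[C R]_k) ord0 j| <= 1.
  by rewrite mxE eqxx; case: (j == a); rewrite ?normr1 ?normr0 ?re1 ?re0 ?ler01.
have [a ->|a ->] := split_ordP i; rewrite ?real_dir_lshift ?real_dir_rshift//.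
by rewrite mxE normrM normCi mul1r.
Qed.

Definition along2 (i j : 'I_(k + k)) p (s t : R) := along j (along i p s) t.

Lemma along2_dist i j p s t a :
  re `|along2 i j p s t ord0 a - p ord0 a| <= `|s| + `|t|.
Proof.
rewrite -le_ofR -normC_ofR /along2 /along !mxE.
have -> : p ord0 a + ofR s * real_dir R i ord0 a + ofR t * real_dir R j ord0 a - p ord0 a
   = ofR s * real_dir R i ord0 a + ofR t * real_dir R j ord0 a by ring.
have h (u : R) i' : `|ofR u * real_dir R i' ord0 a| <= ofR `|u|.
  rewrite normrM norm_ofR ler_piMr//; first by rewrite -[leLHS]ofR0 le_ofR.
  by rewrite normC_ofR -[leRHS]ofR1 le_ofR real_dir_norm.
by rewrite ofRD (le_trans (ler_normD _ _))// lerD.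
Qed.

Lemma along2C i j p s t : along2 i j p s t = along2 j i p t s.
Proof. exact: addrAC. Qed.

Lemma along2_00 i j p : along2 i j p 0 0 = p.
Proof. by rewrite /along2 /along ofR0 !scale0r !addr0. Qed.

Lemma along2_addr i j p s t u : along2 i j p s (t + u) = along j (along2 i j p s t) u.
Proof. rewrite /along2 /along ofRD scalerDl; exact: addrA. Qed.

Lemma along2_addl i j p s t u : along2 i j p (s + u) t = along i (along2 i j p s t) u.
Proof. by rewrite along2C along2_addr (along2C j i). Qed.

Lemma along20 i j p s : along2 i j p s 0 = along i p s.
Proof. by rewrite /along2 /along ofR0 scale0r addr0. Qed.

(** The two real directions of one complex coordinate span its complex
    line. *)
Lemma along2_curve (a : 'I_k) p (c : C R) :
  along2 (lshift k a) (rshift k a) p (re c) (im c) = p + c *: delta_mx ord0 a.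
Proof.
rewrite /along2 /along real_dir_lshift real_dir_rshift scalerA -addrA -scalerDl.
by rewrite mulrC -cplx_re_im.
Qed.

Lemma along2_in D i j p : open D -> D p ->
  exists2 e : R, 0 < e & forall s t, `|s| < e -> `|t| < e -> D (along2 i j p s t).
Proof.
move=> oD Dp; have [e e0 h] := nbhs_box (open_nbhs_nbhs (conj oD Dp)).
exists (e / 2); first by rewrite divr_gt0.
move=> s t se te; apply: h => a; apply: le_lt_trans (along2_dist _ _ _ _ _ _) _.
by rewrite [ltRHS]splitr ltrD.
Qed.

Lemma along_near D i p : open D -> D p -> \forall t \near (0 : R), D (along i p t).
Proof.
move=> oD Dp; have [e e0 h] := along2_in i i oD Dp.
by apply: filterS (nbhs0_lt e0) => t te; rewrite -(along20 i i); apply: h; rewrite ?normr0.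
Qed.

(** [pt] stands for the real or the imaginary part. *)
Lemma continuous2_along2 (pt : C R -> R) f i j p :
  (forall z w, `|pt z - pt w| <= re `|z - w|) -> {for p, continuous f} ->
  continuous2_at0 (fun s t => pt (f (along2 i j p s t))).
Proof.
move=> hpt cf e e0; have [d d0 h] := continuous_box cf e0.
exists (d / 2) => [|s t sd td]; first by rewrite divr_gt0.
rewrite along2_00; apply: le_lt_trans (hpt _ _) _; apply: h => a.
by apply: le_lt_trans (along2_dist _ _ _ _ _ _) _; rewrite [ltRHS]splitr ltrD.
Qed.

End ComplexLimits.

Section PartialDerivatives.
Variables (R : realType) (k : nat).
Implicit Types (D : set 'rV[C R]_k) (p q : 'rV[C R]_k) (f g : 'rV[C R]_k -> C R).
Implicit Types (i j : 'I_(k + k)) (l : C R).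

(** The predicate form of [pderiv]: it carries differentiability along with
    the value, so that the rules of calculus can be chained. *)
Definition is_pderiv i f p l : Prop :=
  is_derive (0 : R) 1 (fun t : R => re (f (along i p t)) : R) (re l) /\
  is_derive (0 : R) 1 (fun t : R => im (f (along i p t)) : R) (im l).

Lemma pderivableP i f p : pderivable i f p -> is_pderiv i f p (pderiv i f p).
Proof.
by move=> [rf imf]; split; rewrite /pderiv /= derive1E; exact: derivableP.
Qed.

Lemma is_pderiv_val i f p l : is_pderiv i f p l -> pderiv i f p = l.
Proof. by move=> [hr hi]; apply: C_eqP; rewrite /pderiv /= derive1E derive_val. Qed.

Lemma is_pderiv_ex i f p l : is_pderiv i f p l -> pderivable i f p.
Proof. by move=> [hr hi]; split; exact: ex_derive. Qed.

Lemma along0 i p : along i p 0 = p.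
Proof. by rewrite /along ofR0 scale0r addr0. Qed.

Lemma is_pderiv_cst i (c : C R) p : is_pderiv i (cst c) p 0.
Proof. by split; rewrite ?re0 ?im0; exact: is_derive_cst. Qed.

Lemma is_pderivD i f g p l l' : is_pderiv i f p l -> is_pderiv i g p l' ->
  is_pderiv i (fun q => f q + g q) p (l + l').
Proof.
move=> [fr fi] [gr gi]; rewrite /is_pderiv reD imD; split.
  have -> : (fun t : R => re (f (along i p t) + g (along i p t))) =
      (fun t : R => re (f (along i p t))) \+ (fun t : R => re (g (along i p t))).
    by apply/funext => t; rewrite reD.
  exact: is_deriveD.
have -> : (fun t : R => im (f (along i p t) + g (along i p t))) =
    (fun t : R => im (f (along i p t))) \+ (fun t : R => im (g (along i p t))).
  by apply/funext => t; rewrite imD.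
exact: is_deriveD.
Qed.

Lemma is_pderivM i f g p l l' : is_pderiv i f p l -> is_pderiv i g p l' ->
  is_pderiv i (fun q => f q * g q) p (l * g p + f p * l').
Proof.
move=> [fr fi] [gr gi].
have der_eq (h : R -> R) x y : is_derive (0 : R) 1 h x -> x = y -> is_derive (0 : R) 1 h y.
  by move=> ? <-.
split.
  have -> : (fun t : R => re (f (along i p t) * g (along i p t))) =
      ((fun t : R => re (f (along i p t))) * (fun t : R => re (g (along i p t))))
      - ((fun t : R => im (f (along i p t))) * (fun t : R => im (g (along i p t)))).
    by apply/funext => t; rewrite reM.
  apply: der_eq (is_deriveB (is_deriveM fr gr) (is_deriveM fi gi)) _.
  by rewrite !along0 !reimE /GRing.scale /=; ring.
have -> : (fun t : R => im (f (along i p t) * g (along i p t))) =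
    ((fun t : R => re (f (along i p t))) * (fun t : R => im (g (along i p t))))
    + ((fun t : R => im (f (along i p t))) * (fun t : R => re (g (along i p t)))).
  by apply/funext => t; rewrite imM.
apply: der_eq (is_deriveD (is_deriveM fr gi) (is_deriveM fi gr)) _.
by rewrite !along0 !reimE /GRing.scale /=; ring.
Qed.

Lemma is_pderiv_coord i a p :
  is_pderiv i (fun q => q ord0 a) p (real_dir R i ord0 a).
Proof.
have der_eq (h : R -> R) x y : is_derive (0 : R) 1 h x -> x = y -> is_derive (0 : R) 1 h y.
  by move=> ? <-.
split.
  have -> : (fun t : R => re (along i p t ord0 a)) =
     cst (re (p ord0 a)) + (fun t : R => t * re (real_dir R i ord0 a)).
    by apply/funext => t; rewrite /along !mxE !reimE /= mul0r subr0.
  apply: der_eq (is_deriveD (is_derive_cst _ _ _)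
    (is_deriveM (is_derive_id _ _) (is_derive_cst _ _ _))) _.
  by rewrite scaler0 !add0r /GRing.scale /= mulr1.
have -> : (fun t : R => im (along i p t ord0 a)) =
   cst (im (p ord0 a)) + (fun t : R => t * im (real_dir R i ord0 a)).
  by apply/funext => t; rewrite /along !mxE !reimE /= mul0r addr0.
apply: der_eq (is_deriveD (is_derive_cst _ _ _)
    (is_deriveM (is_derive_id _ _) (is_derive_cst _ _ _))) _.
by rewrite scaler0 !add0r /GRing.scale /= mulr1.
Qed.

Lemma is_pderiv_conj i f p l : is_pderiv i f p l ->
  is_pderiv i (fun q => (f q)^*) p l^*.
Proof.
move=> [fr fi]; split; rewrite ?reJ ?imJ.
  by under [X in is_derive _ _ X]funext => t do rewrite reJ.
have -> : (fun t : R => im (f (along i p t))^*) = - (fun t : R => im (f (along i p t))).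
  by apply/funext => t; rewrite imJ.
exact: is_deriveN.
Qed.

Lemma is_pderiv_in D i f g p l : open D -> D p -> (forall q, D q -> f q = g q) ->
  is_pderiv i f p l -> is_pderiv i g p l.
Proof.
move=> oD Dp fg [fr fi]; have nD := along_near i oD Dp.
by split; [apply: near_eq_is_derive fr|apply: near_eq_is_derive fi];
  apply: filterS nD => t Dt; rewrite fg.
Qed.

Lemma is_pderiv_sum i (I : Type) (r : seq I) (P : pred I)
    (f : I -> 'rV[C R]_k -> C R) (l : I -> C R) p :
  (forall x, P x -> is_pderiv i (f x) p (l x)) ->
  is_pderiv i (fun q => \sum_(x <- r | P x) f x q) p (\sum_(x <- r | P x) l x).
Proof.
move=> h; elim: r => [|x r IH].
  rewrite big_nil (_ : (fun q => _) = cst 0); first exact: is_pderiv_cst.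
  by apply/funext => q; rewrite big_nil.
rewrite big_cons; case: ifPn => Px.
  rewrite (_ : (fun q => _) = (fun q => f x q + \sum_(x <- r | P x) f x q)).
    by apply: is_pderivD => //; exact: h.
  by apply/funext => q; rewrite big_cons Px.
rewrite (_ : (fun q => _) = (fun q => \sum_(x <- r | P x) f x q))//.
by apply/funext => q; rewrite big_cons (negbTE Px).
Qed.

End PartialDerivatives.

(** * Smooth functions on an open subset of C^k *)

Section SmoothFunctions.
Variables (R : realType) (k : nat) (D : set 'rV[C R]_k).
Hypothesis oD : open D.
Implicit Types (p q : 'rV[C R]_k) (f g : 'rV[C R]_k -> C R).
Implicit Types (i j : 'I_(k + k)) (l : C R).

Lemma Cr_on_continuous r f p : Cr_on r D f -> D p -> {for p, continuous f}.
Proof. by case: r => [|r] /= [h _]; exact: h. Qed.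

Lemma Cr_on_pderiv r f i : Cr_on r.+1 D f -> Cr_on r D (pderiv i f).
Proof. by move=> /= [_ /(_ i)[]]. Qed.

Lemma Cr_on_pderivable r f i p : Cr_on r.+1 D f -> D p -> is_pderiv i f p (pderiv i f p).
Proof. by move=> /= [_ /(_ i)[h _]] Dp; apply: pderivableP; exact: h. Qed.

(** Partial derivatives are local, so on the open set [D] the values outside do
    not matter. *)
Lemma Cr_on_eq r f g : (forall q, D q -> f q = g q) -> Cr_on r D f -> Cr_on r D g.
Proof.
have cont (u v : 'rV[C R]_k -> C R) : (forall q, D q -> u q = v q) ->
    (forall p, D p -> {for p, continuous u}) -> forall p, D p -> {for p, continuous v}.
  move=> uv cu p Dp.
  have nD : \forall q \near p, D q := open_nbhs_nbhs (conj oD Dp).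
  have nE : \forall q \near p, u q = v q by apply: filterS nD => q; exact: uv.
  have h : u @ p --> v p by rewrite -uv//; exact: cu.
  exact: (cvg_trans (near_eq_cvg nE) h).
elim: r f g => [|r IH] f g fg; first by move=> [h _]; split; [exact: (cont f g fg h)|].
move=> [h hd]; split; first exact: (cont f g fg h).
move=> i; have [df cf] := hd i.
have dg p : D p -> is_pderiv i g p (pderiv i f p).
  move=> Dp; exact: (is_pderiv_in oD Dp fg (pderivableP (df p Dp))).
split; first by move=> p Dp; apply: is_pderiv_ex (dg p Dp).
by apply: IH cf => q Dq; rewrite (is_pderiv_val (dg q Dq)).
Qed.

(** The way to raise the order of regularity: it suffices to exhibit partial
    derivatives on [D] that are of class one less. *)
Lemma Cr_on_step r f (g : 'I_(k + k) -> 'rV[C R]_k -> C R) :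
  (forall p, D p -> {for p, continuous f}) ->
  (forall i p, D p -> is_pderiv i f p (g i p)) ->
  (forall i, Cr_on r D (g i)) -> Cr_on r.+1 D f.
Proof.
move=> cf df hg; split; [exact: cf|move=> i; split].
  by move=> p Dp; apply: is_pderiv_ex (df i p Dp).
by apply: Cr_on_eq (hg i) => q Dq; rewrite (is_pderiv_val (df i q Dq)).
Qed.

Lemma Cr_onS r f : Cr_on r.+1 D f -> Cr_on r D f.
Proof.
elim: r f => [|r IH] f [cf hf]; first by split.
split; [exact: cf|move=> i]; have [df cdf] := hf i; split; [exact: df|exact: IH].
Qed.

Lemma Cr_on_cst r (c : C R) : Cr_on r D (cst c).
Proof.
have cc (u : C R) p : {for p, continuous (cst u : 'rV[C R]_k -> C R)}.
  exact: cst_continuous.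
elim: r c => [|r IH] c; first by split; [move=> p _; exact: cc|].
apply: (@Cr_on_step _ _ (fun _ => cst 0)).
- by move=> p _; exact: cc.
- by move=> i p _; exact: is_pderiv_cst.
- by move=> i; exact: IH.
Qed.

Lemma Cr_on_coord r a : Cr_on r D (fun q => q ord0 a).
Proof.
have c p : {for p, continuous (fun q : 'rV[C R]_k => q ord0 a)}.
  exact: coord_continuous.
case: r => [|r]; first by split; [move=> p _; exact: c|].
apply: (@Cr_on_step _ _ (fun i => cst (real_dir R i ord0 a))).
- by move=> p _; exact: c.
- by move=> i p _; exact: is_pderiv_coord.
- by move=> i; exact: Cr_on_cst.
Qed.

Lemma Cr_onD r f g : Cr_on r D f -> Cr_on r D g -> Cr_on r D (fun q => f q + g q).
Proof.
have cD (u v : 'rV[C R]_k -> C R) p : {for p, continuous u} -> {for p, continuous v} ->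
   {for p, continuous (fun q => u q + v q)}.
  by move=> cu cv; exact: (cvgD cu cv).
elim: r f g => [|r IH] f g hf hg.
  by split; [move=> p Dp; apply: cD; apply: Cr_on_continuous Dp; eassumption|].
apply: (@Cr_on_step _ _ (fun i q => pderiv i f q + pderiv i g q)).
- by move=> p Dp; apply: cD; apply: Cr_on_continuous Dp; eassumption.
- by move=> i p Dp; exact: (is_pderivD (Cr_on_pderivable i hf Dp) (Cr_on_pderivable i hg Dp)).
- by move=> i; exact: (IH _ _ (Cr_on_pderiv i hf) (Cr_on_pderiv i hg)).
Qed.

Lemma Cr_onM r f g : Cr_on r D f -> Cr_on r D g -> Cr_on r D (fun q => f q * g q).
Proof.
have cM (u v : 'rV[C R]_k -> C R) p : {for p, continuous u} -> {for p, continuous v} ->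
   {for p, continuous (fun q => u q * v q)}.
  by move=> cu cv; exact: (cvgM cu cv).
elim: r f g => [|r IH] f g hf hg.
  by split; [move=> p Dp; apply: cM; apply: Cr_on_continuous Dp; eassumption|].
apply: (@Cr_on_step _ _ (fun i q => pderiv i f q * g q + f q * pderiv i g q)).
- by move=> p Dp; apply: cM; apply: Cr_on_continuous Dp; eassumption.
- by move=> i p Dp; exact: (is_pderivM (Cr_on_pderivable i hf Dp) (Cr_on_pderivable i hg Dp)).
- by move=> i; exact: (Cr_onD (IH _ _ (Cr_on_pderiv i hf) (Cr_onS hg))
    (IH _ _ (Cr_onS hf) (Cr_on_pderiv i hg))).
Qed.

Lemma Cr_on_sum r (I : Type) (s : seq I) (P : pred I) (F : I -> 'rV[C R]_k -> C R) :
  (forall x, P x -> Cr_on r D (F x)) ->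
  Cr_on r D (fun q => \sum_(x <- s | P x) F x q).
Proof.
move=> h; elim: s => [|x s IH].
  rewrite (_ : (fun q => _) = cst 0); first exact: Cr_on_cst.
  by apply/funext => q; rewrite big_nil.
case: (boolP (P x)) => Px.
  rewrite (_ : (fun q => _) = (fun q => F x q + \sum_(x <- s | P x) F x q)).
    by apply: Cr_onD => //; exact: h.
  by apply/funext => q; rewrite big_cons Px.
rewrite (_ : (fun q => _) = (fun q => \sum_(x <- s | P x) F x q))//.
by apply/funext => q; rewrite big_cons (negbTE Px).
Qed.

Section Positive.
Variable K : 'rV[C R]_k -> R.
Hypothesis K0 : forall p, D p -> 0 < K p.

Let continuous_ofR (u : R -> R) p : {for K p, continuous u} ->
  {for p, continuous (fun q => ofR (K q))} -> {for p, continuous (fun q => ofR (u (K q)))}.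
Proof.
move=> cu cK.
have hK := @cvg_re R _ (nbhs p) (nbhs_filter p) _ _ cK.
have uK := cvg_comp _ _ hK cu.
exact: (@cvg_ofR R _ (nbhs p) (nbhs_filter p) _ _ uK).
Qed.

Let is_pderiv_ofR (u : R -> R) (du : R) i p l : is_derive (K p) 1 u du ->
  is_pderiv i (fun q => ofR (K q)) p l ->
  is_pderiv i (fun q => ofR (u (K q))) p (l * ofR du).
Proof.
move=> hu [hr hi]; split; last first.
  have -> : im (l * ofR du) = 0.
    rewrite imM /= mulr0 add0r.
    have : is_derive (0 : R) 1 (fun _ : R => 0 : R) (im l) := hi.
    by move=> h; have <- := @derive_val _ _ _ _ _ _ _ h; rewrite derive_cst mul0r.
  exact: is_derive_cst.
rewrite reM /= mulr0 subr0 mulrC.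
have hu' : is_derive (K (along i p 0)) 1 u du by rewrite along0.
exact: (@is_derive1_compose R (fun t : R => K (along i p t)) u 0 _ _ hr hu').
Qed.

(** The derivative of [1/K] is [- K' / K^2], a product of functions covered by the
    induction hypothesis. *)
Lemma Cr_on_inv r : Cr_on r D (fun q => ofR (K q)) -> Cr_on r D (fun q => ofR (K q)^-1).
Proof.
have c p : D p -> {for p, continuous (fun q => ofR (K q))} ->
    {for p, continuous (fun q => ofR (K q)^-1)}.
  move=> Dp; apply: (continuous_ofR (u := fun x => x^-1)).
  by apply: inv_continuous; rewrite gt_eqF// K0.
elim: r => [|r IH] hK.
  by split; [move=> p Dp; exact: (c p Dp (Cr_on_continuous hK Dp))|].
apply: (@Cr_on_step _ _ (fun i q =>
    pderiv i (fun q => ofR (K q)) q * ((- 1) * (ofR (K q)^-1 * ofR (K q)^-1)))).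
- by move=> p Dp; exact: (c p Dp (Cr_on_continuous hK Dp)).
- move=> i p Dp.
  have -> : - 1 * (ofR (K p)^-1 * ofR (K p)^-1) = ofR (- (K p) ^- 2) :> C R.
    by rewrite mulN1r ofRN -ofRM -expr2 exprVn.
  apply: (is_pderiv_ofR (u := fun x => x^-1)); last exact: (Cr_on_pderivable i hK Dp).
  have K0p : K p != 0 by rewrite gt_eqF// K0.
  have := is_deriveV K0p (is_derive_id (K p) (1 : R)).
  by rewrite /GRing.scale /= mulr1.
- move=> i; apply: Cr_onM; first exact: (Cr_on_pderiv i hK).
  apply: Cr_onM; first exact: Cr_on_cst.
  exact: (Cr_onM (IH (Cr_onS hK)) (IH (Cr_onS hK))).
Qed.

Lemma Cr_on_ln r : Cr_on r D (fun q => ofR (K q)) -> Cr_on r D (fun q => ofR (ln (K q))).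
Proof.
have c p : D p -> {for p, continuous (fun q => ofR (K q))} ->
    {for p, continuous (fun q => ofR (ln (K q)))}.
  by move=> Dp; apply: continuous_ofR; apply: continuous_ln; exact: K0.
case: r => [|r] hK.
  by split; [move=> p Dp; exact: (c p Dp (Cr_on_continuous hK Dp))|].
apply: (@Cr_on_step _ _ (fun i q => pderiv i (fun q => ofR (K q)) q * ofR (K q)^-1)).
- by move=> p Dp; exact: (c p Dp (Cr_on_continuous hK Dp)).
- move=> i p Dp; apply: is_pderiv_ofR; last exact: (Cr_on_pderivable i hK Dp).
  by apply: is_derive1_ln; exact: K0.
- move=> i; apply: Cr_onM; first exact: (Cr_on_pderiv i hK).
  exact: (Cr_on_inv (Cr_onS hK)).
Qed.

End Positive.

Lemma pderivC f i j p : Cr_on 2 D f -> D p ->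
  pderiv i (pderiv j f) p = pderiv j (pderiv i f) p.
Proof.
move=> hf Dp; have [e e0 De] := along2_in i j oD Dp.
have hfi := Cr_on_pderiv i hf; have hfj := Cr_on_pderiv j hf.
have core (pt : C R -> R) : (forall z w, `|pt z - pt w| <= re `|z - w|) ->
    (forall i' (g : 'rV[C R]_k -> C R) q l, is_pderiv i' g q l ->
       is_derive (0 : R) 1 (fun t : R => pt (g (along i' q t)) : R) (pt l)) ->
    pt (pderiv i (pderiv j f) p) = pt (pderiv j (pderiv i f) p).
  move=> hpt hd.
  have ds (g : 'rV[C R]_k -> C R) (s t : R) r : Cr_on r.+1 D g -> `|s| < e -> `|t| < e ->
      is_derive s 1 (fun s => pt (g (along2 i j p s t))) (pt (pderiv i g (along2 i j p s t))).
    move=> hg se te.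
    apply: (is_derive1_translate_eq _ (hd _ _ _ _ (Cr_on_pderivable i hg (De _ _ se te)))).
    by move=> u; rewrite along2_addl.
  have dt (g : 'rV[C R]_k -> C R) (s t : R) r : Cr_on r.+1 D g -> `|s| < e -> `|t| < e ->
      is_derive t 1 (fun t => pt (g (along2 i j p s t))) (pt (pderiv j g (along2 i j p s t))).
    move=> hg se te.
    apply: (is_derive1_translate_eq _ (hd _ _ _ _ (Cr_on_pderivable j hg (De _ _ se te)))).
    by move=> u; rewrite along2_addr.
  have h : pt (pderiv j (pderiv i f) (along2 i j p 0 0)) =
           pt (pderiv i (pderiv j f) (along2 i j p 0 0)).
    exact: (@clairaut R (fun s t => pt (f (along2 i j p s t)))
      (fun s t => pt (pderiv i f (along2 i j p s t)))
      (fun s t => pt (pderiv j f (along2 i j p s t)))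
      (fun s t => pt (pderiv j (pderiv i f) (along2 i j p s t)))
      (fun s t => pt (pderiv i (pderiv j f) (along2 i j p s t))) e e0
      (fun s t => ds f s t _ hf) (fun s t => dt f s t _ hf)
      (fun s t => dt _ s t _ hfi) (fun s t => ds _ s t _ hfj)
      (continuous2_along2 i j hpt (Cr_on_continuous (Cr_on_pderiv j hfi) Dp))
      (continuous2_along2 i j hpt (Cr_on_continuous (Cr_on_pderiv i hfj) Dp))).
  rewrite along2_00 in h; exact (esym h).
apply: C_eqP; apply: core.
- by move=> z w; rewrite -reN -reD; exact: norm_re_le.
- by move=> i' g q l [].
- by move=> z w; rewrite -imN -imD; exact: norm_im_le.
- by move=> i' g q l [].
Qed.

(** Only one complex coordinate moves, so the chain rule in two real
    variables applies. *)
Lemma derive_curve f p (a : 'I_k) (c : R -> C R) (dc : C R) : Cr_on 1 D f -> D p ->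
  c 0 = 0 -> is_derive (0 : R) 1 (fun t : R => re (c t) : R) (re dc) ->
  is_derive (0 : R) 1 (fun t : R => im (c t) : R) (im dc) ->
  is_derive (0 : R) 1 (fun t : R => re (f (p + c t *: delta_mx ord0 a)) : R)
    (re (pderiv (lshift k a) f p) * re dc + re (pderiv (rshift k a) f p) * im dc).
Proof.
move=> hf Dp c0 dre dim.
have [e e0 De] := along2_in (lshift k a) (rshift k a) oD Dp.
pose F s t := re (f (along2 (lshift k a) (rshift k a) p s t)).
rewrite (_ : (fun t : R => _) = (fun t : R => F (re (c t)) (im (c t)))); last first.
  by apply/funext => t; rewrite /F along2_curve.
have hpt (z w : C R) : `|re z - re w| <= re `|z - w|.
  by rewrite -reN -reD; exact: norm_re_le.
have := @chain_rule2 R F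
  (fun s t => re (pderiv (lshift k a) f (along2 (lshift k a) (rshift k a) p s t)))
  (fun s t => re (pderiv (rshift k a) f (along2 (lshift k a) (rshift k a) p s t)))
  (fun t => re (c t)) (fun t => im (c t)) e (re dc) (im dc) e0.
rewrite along2_00; apply.
- move=> s t se te; have [h _] := Cr_on_pderivable (lshift k a) hf (De _ _ se te).
  by apply: (is_derive1_translate_eq _ h) => u; rewrite /F along2_addl.
- move=> s t se te; have [h _] := Cr_on_pderivable (rshift k a) hf (De _ _ se te).
  by apply: (is_derive1_translate_eq _ h) => u; rewrite /F along2_addr.
- exact: (continuous2_along2 _ _ hpt (Cr_on_continuous (Cr_on_pderiv _ hf) Dp)).
- exact: (continuous2_along2 _ _ hpt (Cr_on_continuous (Cr_on_pderiv _ hf) Dp)).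
- by rewrite c0.
- by rewrite c0.
Qed.

End SmoothFunctions.

(** * Complex covectors and Wirtinger derivatives *)

Section ComplexCovectors.
Variables (R : realType) (k : nat).
Implicit Types (a b : 'I_k) (X Y : 'rV[C R]_(k + k)).

Definition covector_dz a : 'rV[C R]_(k + k) :=
  delta_mx ord0 (lshift k a) + 'i *: delta_mx ord0 (rshift k a).

Definition covector_dzbar a : 'rV[C R]_(k + k) :=
  delta_mx ord0 (lshift k a) - 'i *: delta_mx ord0 (rshift k a).

Lemma dzE a : dz R a = ext_covector (covector_dz a).
Proof. by rewrite /covector_dz ext_covectorD ext_covectorZ. Qed.

Lemma dzbarE a : dzbar R a = ext_covector (covector_dzbar a).
Proof. by rewrite /covector_dzbar ext_covectorD -scaleNr ext_covectorZ scaleNr. Qed.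

Lemma evalv_delta (i : 'I_(k + k)) X : evalv (delta_mx ord0 i) X = X ord0 i.
Proof.
rewrite /evalv (bigD1 i)//= mxE !eqxx mul1r big1 ?addr0// => j ji.
by rewrite mxE (negbTE ji) andbF mul0r.
Qed.

Lemma evalv_dz a X : evalv (covector_dz a) X = X ord0 (lshift k a) + 'i * X ord0 (rshift k a).
Proof. by rewrite /covector_dz evalvD evalvZ !evalv_delta. Qed.

Lemma evalv_dzbar a X :
  evalv (covector_dzbar a) X = X ord0 (lshift k a) - 'i * X ord0 (rshift k a).
Proof. by rewrite /covector_dzbar evalvD -scaleNr evalvZ !evalv_delta mulNr. Qed.

Lemma covector_dz_entries a b :
  (covector_dz a ord0 (lshift k b) = (b == a)%:R) *
  (covector_dz a ord0 (rshift k b) = 'i * (b == a)%:R).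
Proof.
by split; rewrite /covector_dz !mxE !eqxx ?eq_lshift ?eq_rshift ?eq_lrshift ?eq_rlshift
  /= ?mulr0 ?addr0 ?add0r.
Qed.

Lemma covector_dzbar_entries a b :
  (covector_dzbar a ord0 (lshift k b) = (b == a)%:R) *
  (covector_dzbar a ord0 (rshift k b) = - 'i * (b == a)%:R).
Proof.
by split; rewrite /covector_dzbar !mxE !eqxx ?eq_lshift ?eq_rshift ?eq_lrshift ?eq_rlshift
  /= ?mulr0 ?subr0 ?sub0r ?mulNr.
Qed.

Lemma differentialE f p : differential f p =
  \sum_a (wirt a f p *: covector_dz a + wirt_bar a f p *: covector_dzbar a).
Proof.
have E (u v : C R) (A B : 'rV[C R]_(k + k)) i :
  (u *: A + v *: B) ord0 i = u * A ord0 i + v * B ord0 i by rewrite !mxE.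
apply/rowP => i; rewrite summxE mxE; under eq_bigr => a _ do rewrite E.
have [b ->|b ->] := split_ordP i; rewrite (bigD1 b)//=.
- rewrite big1 => [|a ab]; last first.
    by rewrite covector_dz_entries covector_dzbar_entries eq_sym (negbTE ab) !mulr0 addr0.
  rewrite covector_dz_entries covector_dzbar_entries eqxx /= !mulr1 addr0 /wirt /wirt_bar.
  by move: (pderiv _ f p) (pderiv _ f p) => x y; field.
- rewrite big1 => [|a ab]; last first.
    by rewrite covector_dz_entries covector_dzbar_entries eq_sym (negbTE ab) !mulr0 addr0.
  rewrite covector_dz_entries covector_dzbar_entries eqxx /= !mulr1 addr0 /wirt /wirt_bar.
  move: (pderiv _ f p) (pderiv _ f p) => x y.
  transitivity (- 'i ^+ 2 * y); first by rewrite sqrCi opprK mul1r.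
  by field.
Qed.

End ComplexCovectors.

Section Wirtinger.
Variables (R : realType) (k : nat) (D : set 'rV[C R]_k).
Hypothesis oD : open D.
Implicit Types (p q : 'rV[C R]_k) (f g : 'rV[C R]_k -> C R) (a b : 'I_k).

Lemma wirt_in a f g p : Cr_on 1 D f -> D p -> (forall q, D q -> f q = g q) ->
  wirt a f p = wirt a g p.
Proof.
move=> hf Dp fg; rewrite /wirt.
have E i : pderiv i g p = pderiv i f p.
  exact (is_pderiv_val (is_pderiv_in oD Dp fg (Cr_on_pderivable i hf Dp))).
by rewrite !E.
Qed.

Lemma wirt_sum a (I : Type) (r : seq I) (P : pred I) (F : I -> 'rV[C R]_k -> C R) p :
  (forall x, Cr_on 1 D (F x)) -> D p ->
  wirt a (fun q => \sum_(x <- r | P x) F x q) p = \sum_(x <- r | P x) wirt a (F x) p.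
Proof.
move=> hF Dp; rewrite /wirt.
have E i : pderiv i (fun q => \sum_(x <- r | P x) F x q) p =
    \sum_(x <- r | P x) pderiv i (F x) p.
  exact (is_pderiv_val (is_pderiv_sum r (P := P) (fun x _ => Cr_on_pderivable i (hF x) Dp))).
by rewrite !E mulr_sumr -sumrB mulr_sumr.
Qed.

Lemma wirt_bar_sum a (I : Type) (r : seq I) (P : pred I) (F : I -> 'rV[C R]_k -> C R) p :
  (forall x, Cr_on 1 D (F x)) -> D p ->
  wirt_bar a (fun q => \sum_(x <- r | P x) F x q) p = \sum_(x <- r | P x) wirt_bar a (F x) p.
Proof.
move=> hF Dp; rewrite /wirt_bar.
have E i : pderiv i (fun q => \sum_(x <- r | P x) F x q) p =
    \sum_(x <- r | P x) pderiv i (F x) p.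
  exact (is_pderiv_val (is_pderiv_sum r (P := P) (fun x _ => Cr_on_pderivable i (hF x) Dp))).
by rewrite !E mulr_sumr -big_split mulr_sumr.
Qed.

Lemma wirtM a f g p : Cr_on 1 D f -> Cr_on 1 D g -> D p ->
  wirt a (fun q => f q * g q) p = wirt a f p * g p + f p * wirt a g p.
Proof.
move=> hf hg Dp; rewrite /wirt.
have E i : pderiv i (fun q => f q * g q) p = pderiv i f p * g p + f p * pderiv i g p.
  exact (is_pderiv_val (is_pderivM (Cr_on_pderivable i hf Dp) (Cr_on_pderivable i hg Dp))).
rewrite !E; move: (pderiv _ f p) (pderiv _ g p) (pderiv _ f p) (pderiv _ g p) => x y z t.
by ring.
Qed.

Lemma wirt_barM a f g p : Cr_on 1 D f -> Cr_on 1 D g -> D p ->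
  wirt_bar a (fun q => f q * g q) p = wirt_bar a f p * g p + f p * wirt_bar a g p.
Proof.
move=> hf hg Dp; rewrite /wirt_bar.
have E i : pderiv i (fun q => f q * g q) p = pderiv i f p * g p + f p * pderiv i g p.
  exact (is_pderiv_val (is_pderivM (Cr_on_pderivable i hf Dp) (Cr_on_pderivable i hg Dp))).
rewrite !E; move: (pderiv _ f p) (pderiv _ g p) (pderiv _ f p) (pderiv _ g p) => x y z t.
by ring.
Qed.

Lemma wirt_bar_coord a b p : wirt_bar a (fun q => q ord0 b) p = 0.
Proof.
rewrite /wirt_bar !(is_pderiv_val (is_pderiv_coord _ _ _)).
rewrite real_dir_lshift real_dir_rshift !mxE eqxx /= mulrA -expr2 sqrCi mulN1r.
by rewrite subrr mulr0.
Qed.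

Lemma wirt_coord_conj a b p : wirt a (fun q => (q ord0 b)^*) p = 0.
Proof.
rewrite /wirt !(is_pderiv_val (is_pderiv_conj (is_pderiv_coord _ _ _))).
rewrite real_dir_lshift real_dir_rshift !mxE eqxx /=.
by case: (b == a); apply: C_eqP; rewrite !reimE /=; ring.
Qed.

Lemma wirt_cst a (c : C R) p : wirt a (cst c) p = 0.
Proof. by rewrite /wirt !(is_pderiv_val (is_pderiv_cst _ _ _)) mulr0 subr0 mulr0. Qed.

Lemma wirt_bar_cst a (c : C R) p : wirt_bar a (cst c) p = 0.
Proof. by rewrite /wirt_bar !(is_pderiv_val (is_pderiv_cst _ _ _)) mulr0 addr0 mulr0. Qed.

Lemma Cr_on_wirt r a f : Cr_on r.+1 D f -> Cr_on r D (wirt a f).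
Proof.
move=> hf; have hN : Cr_on r D (fun q => cst (- 'i) q * pderiv (rshift k a) f q).
  exact (Cr_onM oD (Cr_on_cst oD r _) (Cr_on_pderiv _ hf)).
have h2 := Cr_onM oD (Cr_on_cst oD r (2^-1)) (Cr_onD oD (Cr_on_pderiv (lshift k a) hf) hN).
apply: Cr_on_eq h2 => // q Dq.
by rewrite /wirt /cst mulNr.
Qed.

Lemma Cr_on_wirt_bar r a f : Cr_on r.+1 D f -> Cr_on r D (wirt_bar a f).
Proof.
move=> hf; have hN : Cr_on r D (fun q => cst 'i q * pderiv (rshift k a) f q).
  exact (Cr_onM oD (Cr_on_cst oD r _) (Cr_on_pderiv _ hf)).
exact (Cr_onM oD (Cr_on_cst oD r (2^-1)) (Cr_onD oD (Cr_on_pderiv (lshift k a) hf) hN)).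
Qed.

Lemma pderiv_wirt i a f p : Cr_on 2 D f -> D p ->
  pderiv i (wirt a f) p =
  2^-1 * (pderiv i (pderiv (lshift k a) f) p - 'i * pderiv i (pderiv (rshift k a) f) p).
Proof.
move=> hf Dp.
have hl := Cr_on_pderivable i (Cr_on_pderiv (lshift k a) hf) Dp.
have hr := Cr_on_pderivable i (Cr_on_pderiv (rshift k a) hf) Dp.
have h1 := is_pderivM (is_pderiv_cst i (- 'i) p) hr.
have h2 := is_pderivM (is_pderiv_cst i (2^-1) p) (is_pderivD hl h1).
have E : wirt a f = (fun q => cst (2^-1) q * (pderiv (lshift k a) f q +
     cst (- 'i) q * pderiv (rshift k a) f q)).
  by apply/funext => q; rewrite /wirt /cst mulNr.
have alg (c u x y z v : C R) : 0 * u + c * (x + (0 * z + (- v) * y)) = c * (x - v * y).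
  by ring.
rewrite E; exact (etrans (is_pderiv_val h2) (alg _ _ _ _ _ _)).
Qed.

Lemma pderiv_wirt_bar i a f p : Cr_on 2 D f -> D p ->
  pderiv i (wirt_bar a f) p =
  2^-1 * (pderiv i (pderiv (lshift k a) f) p + 'i * pderiv i (pderiv (rshift k a) f) p).
Proof.
move=> hf Dp.
have hl := Cr_on_pderivable i (Cr_on_pderiv (lshift k a) hf) Dp.
have hr := Cr_on_pderivable i (Cr_on_pderiv (rshift k a) hf) Dp.
have h1 := is_pderivM (is_pderiv_cst i 'i p) hr.
have h2 := is_pderivM (is_pderiv_cst i (2^-1) p) (is_pderivD hl h1).
have E : wirt_bar a f = (fun q => cst (2^-1) q * (pderiv (lshift k a) f q +
     cst 'i q * pderiv (rshift k a) f q)) by [].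
have alg (c u x y z v : C R) : 0 * u + c * (x + (0 * z + v * y)) = c * (x + v * y).
  by ring.
rewrite E; exact (etrans (is_pderiv_val h2) (alg _ _ _ _ _ _)).
Qed.

Lemma wirt_wirt_barC a b f p : Cr_on 2 D f -> D p ->
  wirt_bar b (wirt a f) p = wirt a (wirt_bar b f) p.
Proof.
move=> hf Dp.
have alg (c j ll lr rl rr ll' lr' rl' rr' : C R) :
    ll = ll' -> lr = rl' -> rl = lr' -> rr = rr' ->
    c * (c * (ll - j * lr) + j * (c * (rl - j * rr))) =
    c * (c * (ll' + j * lr') - j * (c * (rl' + j * rr'))).
  by move=> -> -> -> ->; ring.
have Ew i := pderiv_wirt i a hf Dp; have Eb i := pderiv_wirt_bar i b hf Dp.
have -> : wirt_bar b (wirt a f) p = 2^-1 * (pderiv (lshift k b) (wirt a f) p +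
  'i * pderiv (rshift k b) (wirt a f) p) by [].
have -> : wirt a (wirt_bar b f) p = 2^-1 * (pderiv (lshift k a) (wirt_bar b f) p -
  'i * pderiv (rshift k a) (wirt_bar b f) p) by [].
rewrite !Ew !Eb; exact (alg _ _ _ _ _ _ _ _ _ _
  (pderivC oD (lshift k b) (lshift k a) hf Dp) (pderivC oD (lshift k b) (rshift k a) hf Dp)
  (pderivC oD (rshift k b) (lshift k a) hf Dp) (pderivC oD (rshift k b) (rshift k a) hf Dp)).
Qed.

Lemma pderiv_real i (h : 'rV[C R]_k -> R) p : im (pderiv i (fun q => ofR (h q)) p) = 0.
Proof. exact: derive1_cst. Qed.

Lemma wirt_conj_real a (h : 'rV[C R]_k -> R) p :
  (wirt a (fun q => ofR (h q)) p)^* = wirt_bar a (fun q => ofR (h q)) p.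
Proof.
have alg (z w : C R) : im z = 0 -> im w = 0 ->
    (2^-1 * (z - 'i * w))^* = 2^-1 * (z + 'i * w).
  move=> /im_eq0 -> /im_eq0 ->; rewrite rmorphM rmorphB rmorphM /=.
  have -> : (2^-1 : C R)^* = 2^-1 by rewrite fmorphV rmorph_nat.
  by rewrite conjCi !ofR_conj mulNr opprK.
exact (alg _ _ (pderiv_real _ _ _) (pderiv_real _ _ _)).
Qed.

End Wirtinger.

(** * Rotations of the z-coordinates and the moment map *)

Section LastRotations.
Variables (R : realType) (m n : nat) (D : set 'rV[C R]_(m + n)).
Implicit Types (p q : 'rV[C R]_(m + n)) (t : 'I_n -> R).

(** Rotating the coordinates of the slice by independent angles.  The action
    uses equal angles; a single angle gives an equation for each coordinate. *)
Definition rotate_last t p : 'rV[C R]_(m + n) :=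
  row_mx (lsubmx p) (rotate t (rsubmx p)).

Lemma rotate_zE theta p : rotate_z theta p = rotate_last (fun _ => theta) p.
Proof. by congr row_mx; apply/rowP => j; rewrite !mxE. Qed.

Lemma rotate_last_row t w z : rotate_last t (row_mx w z) = row_mx w (rotate t z).
Proof. by rewrite /rotate_last row_mxKl row_mxKr. Qed.

Lemma rotate_last_in t p : bounded_reinhardt_domain D -> D p -> D (rotate_last t p).
Proof.
move=> [_ _ _ _ inv] Dp.
have -> : rotate_last t p = \row_j (cis (match fintype.split j with
    | inl _ => 0 | inr b => t b end) * p ord0 j).
  apply/rowP => j; rewrite [RHS]mxE /rotate_last.
  have [b ->|b ->] := split_ordP j.
    by rewrite row_mxEl mxE cis0 mul1r.
  by rewrite row_mxEr !mxE.
exact: inv.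
Qed.

Variable Kw : 'rV[C R]_m -> 'rV[C R]_n -> 'rV[C R]_n -> C R.
Variable K : 'rV[C R]_(m + n) -> R.
Hypothesis hD : bounded_reinhardt_domain D.
Hypothesis hKw : forall w, slice D w !=set0 -> is_bergman_kernel (slice D w) (Kw w).
Hypothesis hK : forall w z, slice D w z -> ofR (K (row_mx w z)) = Kw w z z.

Lemma kernel_rotate_last t p : D p -> K (rotate_last t p) = K p.
Proof.
move=> Dp; set w := lsubmx p; set z := rsubmx p.
have Uz : slice D w z by rewrite /slice /= hsubmxK.
have inU s z' : slice D w z' -> slice D w (rotate s z').
  by move=> h; rewrite /slice /= -rotate_last_row; exact: rotate_last_in.
have Ut z' : slice D w (rotate t z') <-> slice D w z'.
  by split=> [/(inU (fun j => - t j))|]; [rewrite rotateK|exact: inU].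
have := bergman_kernel_diag_rotate Ut (hKw (ex_intro _ z Uz)) Uz.
rewrite -hK// -hK; last exact: inU.
rewrite ofR_conj -rotate_last_row hsubmxK => h.
by apply/esym/ofR_inj.
Qed.

Lemma kernel_gt0 p : D p -> 0 < K p.
Proof.
move=> Dp; set w := lsubmx p; set z := rsubmx p.
have Uz : slice D w z by rewrite /slice /= hsubmxK.
have [_ _ _ bD _] := hD; have [M hM] := bounded_set_coord bD.
have hMU z' : slice D w z' -> forall j, `|z' ord0 j| <= ofR M.
  by move=> /hM h j; have := h (rshift m j); rewrite row_mxEr.
apply: (bergman_kernel_diag_gt0 hMU (hKw (ex_intro _ z Uz)) Uz).
by rewrite -hK// hsubmxK.
Qed.

End LastRotations.

Section MomentMap.
Variables (R : realType) (m n : nat) (D : set 'rV[C R]_(m + n)).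
Variable L : 'rV[C R]_(m + n) -> R.
Hypothesis oD : open D.
Hypothesis D_rot : forall t p, D p -> D (rotate_last t p).
Hypothesis L_smooth : forall r, Cr_on r D (fun q => ofR (L q)).
Hypothesis L_rot : forall t p, D p -> L (rotate_last t p) = L p.
Implicit Types (p q : 'rV[C R]_(m + n)) (j : 'I_n).

Let f : 'rV[C R]_(m + n) -> C R := fun q => ofR (L q).

Definition moment p : C R :=
  - 2^-1 * \sum_(j < n) p ord0 (rshift m j) * wirt (rshift m j) f p.

Let z j p : C R := p ord0 (rshift m j).
Let dir j : 'rV[C R]_(m + n) := delta_mx ord0 (rshift m j).
Let fx j p : R := re (pderiv (lshift (m + n) (rshift m j)) f p).
Let fy j p : R := re (pderiv (rshift (m + n) (rshift m j)) f p).

Lemma wirt_parts j p : wirt (rshift m j) f p = 2^-1 * (ofR (fx j p) - 'i * ofR (fy j p)).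
Proof.
have alg (x y : C R) : im x = 0 -> im y = 0 ->
   2^-1 * (x - 'i * y) = 2^-1 * (ofR (re x) - 'i * ofR (re y)).
  by move=> /im_eq0 {1}-> /im_eq0 {1}->.
exact (alg _ _ (pderiv_real _ _ _) (pderiv_real _ _ _)).
Qed.

Definition radial j p : R := fx j p * re (z j p) + fy j p * im (z j p).

Lemma radialP j p : D p ->
  is_derive (0 : R) 1 (fun s : R => L (p + (ofR s * z j p) *: dir j)) (radial j p).
Proof.
move=> Dp; have line (a : R) : is_derive (0 : R) 1 (fun s : R => s * a) a.
  have h := is_deriveM (is_derive_id (0 : R) (1 : R)) (is_derive_cst a (0 : R) (1 : R)).
  by rewrite scaler0 add0r /GRing.scale /= mulr1 in h.
have hre : is_derive (0 : R) 1 (fun s : R => re (ofR s * z j p) : R) (re (z j p)).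
  rewrite (_ : (fun s => _) = (fun s : R => s * re (z j p))); first exact: line.
  by apply/funext => s; rewrite reM /= mul0r subr0.
have him : is_derive (0 : R) 1 (fun s : R => im (ofR s * z j p) : R) (im (z j p)).
  rewrite (_ : (fun s => _) = (fun s : R => s * im (z j p))); first exact: line.
  by apply/funext => s; rewrite imM /= mul0r addr0.
have c0 : ofR 0 * z j p = 0 by rewrite ofR0 mul0r.
exact (derive_curve (c := fun s => ofR s * z j p) oD (rshift m j) (L_smooth 1) Dp
  c0 hre him).
Qed.

(** Rotation of one coordinate is motion along one complex line, as needed by the
    chain rule. *)
Lemma rotate_one j (theta : R) p :
  p + ((cis theta - 1) * z j p) *: dir j =
  rotate_last (fun i => if i == j then theta else 0) p.
Proof.
apply/rowP => i; rewrite !mxE.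
have [b ->|b ->] := split_ordP i.
  by rewrite mxE eq_lrshift andbF mulr0 addr0.
rewrite !mxE eq_rshift; case: (eqVneq b j) => [->|bj] /=.
  by rewrite /z mulr1 mulrBl mul1r addrC subrK.
by rewrite mulr0 addr0 cis0 mul1r.
Qed.

(** [L] is constant on the circle through [p] in the coordinate [z_j]; this
    is the vanishing of its derivative there, whose direction is [i z_j]. *)
Lemma rotational_derivative j p : D p -> fy j p * re (z j p) = fx j p * im (z j p).
Proof.
move=> Dp.
have hre : is_derive (0 : R) 1 (fun t : R => re ((cis t - 1) * z j p) : R) (re ('i * z j p)).
  have -> : (fun t : R => re ((cis t - 1) * z j p)) =
      (fun t : R => (cos t - 1) * re (z j p) - sin t * im (z j p)).
    by apply/funext => t; rewrite !reimE /= subr0.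
  apply: is_derive_eq; rewrite !reimE /= ?sin0 ?cos0 /GRing.scale /=; ring.
have him : is_derive (0 : R) 1 (fun t : R => im ((cis t - 1) * z j p) : R) (im ('i * z j p)).
  have -> : (fun t : R => im ((cis t - 1) * z j p)) =
      (fun t : R => (cos t - 1) * im (z j p) + sin t * re (z j p)).
    by apply/funext => t; rewrite !reimE /= subr0.
  apply: is_derive_eq; rewrite !reimE /= ?sin0 ?cos0 /GRing.scale /=; ring.
have c0 : (cis 0 - 1) * z j p = 0 by rewrite cis0 subrr mul0r.
have h := derive_curve (c := fun t => (cis t - 1) * z j p) (dc := 'i * z j p)
  oD (rshift m j) (L_smooth 1) Dp c0 hre him.
have E : (fun t : R => re (ofR (L (p + ((cis t - 1) * z j p) *: dir j)) : C R)) = cst (L p).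
  by apply/funext => t; rewrite rotate_one /= L_rot.
have v1 := @derive_val _ _ _ _ _ _ _ h.
have v2 : 'D_1 (fun t : R => re (ofR (L (p + ((cis t - 1) * z j p) *: dir j)) : C R)) 0 = 0.
  by rewrite E derive_cst.
have alg (a b : R) (w : C R) : a * re ('i * w) + b * im ('i * w) = 0 -> b * re w = a * im w.
  by rewrite !reimE => e; apply/eqP; rewrite -subr_eq0 -e; apply/eqP; ring.
exact (alg _ _ _ (etrans (esym v1) v2)).
Qed.

Lemma half_ofR : 2^-1 = ofR (2^-1) :> C R.
Proof. by rewrite ofRV; congr (_^-1); apply: C_eqP; rewrite /= ?addr0. Qed.

(** Up to the factor 1/2, the imaginary part of [z_j dL/dz_j] is the derivative
    along the circle, which vanishes, and the real part is the one along the
    ray. *)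
Lemma coord_wirt j p : D p -> z j p * wirt (rshift m j) f p = ofR (2^-1 * radial j p).
Proof.
move=> Dp; rewrite wirt_parts /radial.
have alg (w : C R) (a b : R) : b * re w = a * im w ->
    w * (2^-1 * (ofR a - 'i * ofR b)) = ofR (2^-1 * (a * re w + b * im w)).
  move=> e; rewrite half_ofR; apply: C_eqP; rewrite !reimE /=; first by ring.
  transitivity (2^-1 * (a * im w - b * re w)); first by ring.
  by rewrite e subrr mulr0.
exact (alg _ _ _ (rotational_derivative j Dp)).
Qed.

Lemma moment_real p : D p -> moment p = ofR (- 2^-1 * \sum_j 2^-1 * radial j p).
Proof.
move=> Dp; rewrite /moment (eq_bigr _ (fun j _ => coord_wirt j Dp)).
by rewrite ofRM ofRN -half_ofR (big_morph _ (@ofRD R) (ofR0 R)).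
Qed.

Lemma Cr_on_moment r : Cr_on r D moment.
Proof.
apply: (Cr_onM oD (Cr_on_cst oD r (- 2^-1))); apply: (Cr_on_sum oD) => j _.
exact (Cr_onM oD (Cr_on_coord oD r _) (Cr_on_wirt oD _ (L_smooth r.+1))).
Qed.

(** The action maps the ray of [p] to the ray of the image point, and [L] takes
    the same values on both. *)
Lemma radial_rotate theta j p : D p -> radial j (rotate_z theta p) = radial j p.
Proof.
move=> Dp; rewrite rotate_zE; set t := fun _ : 'I_n => theta; set Tp := rotate_last t p.
have DTp : D Tp by exact: D_rot.
have Tline (s : R) : Tp + (ofR s * z j Tp) *: dir j =
    rotate_last t (p + (ofR s * z j p) *: dir j).
  apply/rowP => i; rewrite /Tp /rotate_last !mxE.
  have [b ->|b ->] := split_ordP i.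
    by rewrite !mxE eq_lrshift andbF !mulr0 !addr0.
  rewrite !mxE eq_rshift /z /rotate_last row_mxEr !mxE.
  by case: (b == j); rewrite /= ?mulr1 ?mulr0 ?addr0//; ring.
have [e e0 De] := along2_in (lshift (m + n) (rshift m j)) (rshift (m + n) (rshift m j)) oD Dp.
have small (a : R) : \forall s \near (0 : R), `|s * a| < e.
  have : (fun s : R => s * a) @ (0 : R) --> (0 * a : R) by exact: mulrr_continuous.
  rewrite mul0r => /cvgrPdist_lt /(_ _ e0); apply: filterS => s.
  by rewrite sub0r normrN.
have nD : \forall s \near (0 : R), L (p + (ofR s * z j p) *: dir j) =
                                   L (Tp + (ofR s * z j Tp) *: dir j).
  apply: filterS2 (small (re (z j p))) (small (im (z j p))) => s s1 s2.
  rewrite Tline L_rot//.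
  have := De _ _ s1 s2.
  have -> : s * re (z j p) = re (ofR s * z j p) by rewrite reM /= mul0r subr0.
  have -> : s * im (z j p) = im (ofR s * z j p) by rewrite imM /= mul0r addr0.
  by rewrite along2_curve.
have h1 := near_eq_is_derive nD (radialP j Dp); have h2 := radialP j DTp.
by rewrite -(@derive_val _ _ _ _ _ _ _ h1) -(@derive_val _ _ _ _ _ _ _ h2).
Qed.

Lemma moment_rotate theta p : D p -> moment (rotate_z theta p) = moment p.
Proof.
move=> Dp; rewrite !moment_real//; last by rewrite rotate_zE; exact: D_rot.
by under eq_bigr => j _ do rewrite radial_rotate//.
Qed.

Let c a b p := wirt a (wirt_bar b f) p.

(** [z_j] is holomorphic, so [d/dzbar_b] falls on the derivative of [L]
    only. *)
Lemma wirt_bar_moment b p : D p ->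
  wirt_bar b moment p = - 2^-1 * \sum_j z j p * c (rshift m j) b p.
Proof.
move=> Dp.
have hw j : Cr_on 1 D (fun q => q ord0 (rshift m j) * wirt (rshift m j) f q).
  exact (Cr_onM oD (Cr_on_coord oD 1 _) (Cr_on_wirt oD _ (L_smooth 2))).
have E1 := wirt_barM b (Cr_on_cst oD 1 (- 2^-1)) (Cr_on_sum oD (r := 1)
  (index_enum 'I_n) (P := xpredT) (fun j _ => hw j)) Dp.
have alg (x y s u : C R) : x = 0 * y + s * u -> x = s * u by move=> ->; ring.
rewrite wirt_bar_cst in E1; refine (etrans (alg _ _ _ _ E1) _).
congr (_ * _); refine (etrans (wirt_bar_sum b _ _ hw Dp) _).
apply: eq_bigr => j _.
refine (etrans (wirt_barM b (Cr_on_coord oD 1 _) (Cr_on_wirt oD _ (L_smooth 2)) Dp) _).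
by rewrite wirt_bar_coord mul0r add0r (wirt_wirt_barC oD _ _ (L_smooth 2) Dp).
Qed.

Lemma Cr_on_coord_conj r a : Cr_on r D (fun q => (q ord0 a)^*).
Proof.
have ct p : {for p, continuous (fun q : 'rV[C R]_(m + n) => (q ord0 a)^*)}.
  have hc : {for p, continuous (fun q : 'rV[C R]_(m + n) => q ord0 a)}.
    exact: coord_continuous.
  have h1 := @cvg_re R _ (nbhs p) (nbhs_filter p) _ _ hc.
  have h2 := @cvg_ofR R _ (nbhs p) (nbhs_filter p) _ _ h1.
  have h3 := @cvgD _ _ _ _ (nbhs_filter p) _ _ _ _ h2 h2.
  have h4 := @cvgB _ _ _ _ (nbhs_filter p) _ _ _ _ h3 hc.
  have E (w : C R) : w^* = ofR (re w) + ofR (re w) - w.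
    by apply: C_eqP; rewrite !reimE /=; ring.
  rewrite /prop_for /continuous_at E (_ : (fun q => _) =
    (fun q : 'rV[C R]_(m + n) => ofR (re (q ord0 a)) + ofR (re (q ord0 a)) - q ord0 a)).
    exact h4.
  by apply/funext => q; exact: E.
case: r => [|r]; first by split; [move=> p _; exact: ct|].
apply: (Cr_on_step oD (g := fun i => cst (real_dir R i ord0 a)^*)).
- by move=> p _; exact: ct.
- by move=> i p _; exact: (is_pderiv_conj (is_pderiv_coord i a p)).
- by move=> i; exact: Cr_on_cst.
Qed.

(** Since the terms [z_j dL/dz_j] are real, they equal their conjugates
    [conj z_j dL/dzbar_j], in which the coefficient is antiholomorphic. *)
Lemma wirt_moment a p : D p ->
  wirt a moment p = - 2^-1 * \sum_j (z j p)^* * c a (rshift m j) p.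
Proof.
move=> Dp.
have hw j : Cr_on 1 D (fun q => (q ord0 (rshift m j))^* * wirt_bar (rshift m j) f q).
  exact (Cr_onM oD (Cr_on_coord_conj 1 _) (Cr_on_wirt_bar oD _ (L_smooth 2))).
have E q : D q -> moment q = cst (- 2^-1) q *
    \sum_(j < n) (q ord0 (rshift m j))^* * wirt_bar (rshift m j) f q.
  move=> Dq; rewrite /moment /cst; congr (_ * _); apply: eq_bigr => j _.
  have h := coord_wirt j Dq.
  have alg (x w w' : C R) (r : R) : w^* = w' -> x * w = ofR r -> x * w = x^* * w'.
    have xw : (x * w)^* = x^* * w^* by exact: rmorphM.
    by move=> <- e; rewrite -xw e ofR_conj.
  exact (alg _ _ _ _ (wirt_conj_real _ _ _) h).
refine (etrans (wirt_in oD a (Cr_on_moment 1) Dp E) _).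
have E1 := wirtM a (Cr_on_cst oD 1 (- 2^-1)) (Cr_on_sum oD (r := 1)
  (index_enum 'I_n) (P := xpredT) (fun j _ => hw j)) Dp.
have alg (x y s u : C R) : x = 0 * y + s * u -> x = s * u by move=> ->; ring.
rewrite wirt_cst in E1; refine (etrans (alg _ _ _ _ E1) _).
congr (_ * _); refine (etrans (wirt_sum a _ _ hw Dp) _).
apply: eq_bigr => j _.
refine (etrans (wirtM a (Cr_on_coord_conj 1 _) (Cr_on_wirt_bar oD _ (L_smooth 2)) Dp) _).
by rewrite wirt_coord_conj mul0r add0r.
Qed.

End MomentMap.

(** * The annihilator condition *)

Section RealCoordinates.
Variables (R : realType) (k : nat).

Lemma real_coord_lshift (a : 'I_k) (p : 'rV[C R]_k) :
  real_coord (lshift k a) p = re (p ord0 a).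
Proof. by rewrite /real_coord (unsplitK (inl a)). Qed.

Lemma real_coord_rshift (a : 'I_k) (p : 'rV[C R]_k) :
  real_coord (rshift k a) p = im (p ord0 a).
Proof. by rewrite /real_coord (unsplitK (inr a)). Qed.

End RealCoordinates.

Section Annihilator.
Variables (R : realType) (m n : nat) (D : set 'rV[C R]_(m + n)).
Variable L : 'rV[C R]_(m + n) -> R.
Hypothesis oD : open D.
Hypothesis D_rot : forall t p, D p -> D (rotate_last t p).
Hypothesis L_smooth : forall r, Cr_on r D (fun q => ofR (L q)).
Hypothesis L_rot : forall t p, D p -> L (rotate_last t p) = L p.
Implicit Types (p q : 'rV[C R]_(m + n)) (j : 'I_n).

Let f : 'rV[C R]_(m + n) -> C R := fun q => ofR (L q).
Let c a b p := wirt a (wirt_bar b f) p.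

Lemma delbar_fun_form q : delbar (fun_form f) q =
  \sum_b wirt_bar b f q *: ext_covector (covector_dzbar R b).
Proof.
apply: eq_bigr => b _; rewrite dzbarE.
rewrite (_ : [ffun S => _] = ext_scalar _ (wirt_bar b f q)) ?wedge_scalarr//.
apply/ffunP => S; rewrite !ffunE /fun_form.
case: ifPn => [/eqP ->|S0].
  by congr (wirt_bar b _ q); apply/funext => q'; rewrite ffunE eqxx.
rewrite (_ : (fun q' => _) = cst 0) ?wirt_bar_cst//.
by apply/funext => q'; rewrite ffunE (negbTE S0).
Qed.

Lemma del_delbar_fun_form p : D p -> del (delbar (fun_form f)) p =
  \sum_a wedge (ext_covector (covector_dz R a))
    (\sum_b c a b p *: ext_covector (covector_dzbar R b)).
Proof.
move=> Dp; apply: eq_bigr => a _; rewrite dzE; congr wedge.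
apply/ffunP => S; rewrite ffunE sum_ffunE.
have -> : (fun q => delbar (fun_form f) q S) =
    (fun q => \sum_b wirt_bar b f q * cst (ext_covector (covector_dzbar R b) S) q).
  apply/funext => q; rewrite delbar_fun_form sum_ffunE.
  by apply: eq_bigr => b _; rewrite ext_scaleE.
have hb b := Cr_on_wirt_bar oD b (L_smooth 2).
have hc b : Cr_on 1 D (fun q => wirt_bar b f q *
    cst (ext_covector (covector_dzbar R b) S) q).
  exact (Cr_onM oD (hb b) (Cr_on_cst oD 1 _)).
refine (etrans (wirt_sum a _ _ hc Dp) _); apply: eq_bigr => b _.
refine (etrans (wirtM a (hb b) (Cr_on_cst oD 1 _) Dp) _).
by rewrite wirt_cst mulr0 addr0 ext_scaleE.
Qed.

Let X p := fundamental_field (@rotate_z R m n) p.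

Lemma fundamental_rotate_w p (b : 'I_m) :
  (X p ord0 (lshift (m + n) (lshift n b)) = 0) *
  (X p ord0 (rshift (m + n) (lshift n b)) = 0).
Proof.
split; rewrite mxE.
  rewrite (_ : (fun theta => _) = cst (real_coord (lshift (m + n) (lshift n b)) p)).
    by rewrite derive1_cst.
  by apply/funext => t; rewrite /= !real_coord_lshift /rotate_z row_mxEl mxE.
rewrite (_ : (fun theta => _) = cst (real_coord (rshift (m + n) (lshift n b)) p)).
  by rewrite derive1_cst.
by apply/funext => t; rewrite /= !real_coord_rshift /rotate_z row_mxEl mxE.
Qed.

Lemma fundamental_rotate_z p j :
  (X p ord0 (lshift (m + n) (rshift m j)) = ofR (- im (p ord0 (rshift m j)))) *
  (X p ord0 (rshift (m + n) (rshift m j)) = ofR (re (p ord0 (rshift m j)))).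
Proof.
split; rewrite mxE; congr ofR.
  rewrite -[RHS](derive1_rot_re (re (p ord0 (rshift m j)))); congr (derive1 _ 0).
  by apply/funext => t; rewrite real_coord_lshift /rotate_z row_mxEr !mxE reM.
rewrite -[RHS](derive1_rot_im _ (im (p ord0 (rshift m j)))); congr (derive1 _ 0).
by apply/funext => t; rewrite real_coord_rshift /rotate_z row_mxEr !mxE imM.
Qed.

Lemma evalv_rotate_w p (b : 'I_m) :
  (evalv (covector_dz R (lshift n b)) (X p) = 0) *
  (evalv (covector_dzbar R (lshift n b)) (X p) = 0).
Proof. by rewrite evalv_dz evalv_dzbar !fundamental_rotate_w mulr0 addr0 subr0. Qed.

Lemma evalv_rotate_z p j :
  (evalv (covector_dz R (rshift m j)) (X p) = 'i * p ord0 (rshift m j)) *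
  (evalv (covector_dzbar R (rshift m j)) (X p) = - 'i * (p ord0 (rshift m j))^*).
Proof.
rewrite evalv_dz evalv_dzbar !fundamental_rotate_z.
by split; apply: C_eqP; rewrite !reimE /=; ring.
Qed.

(** The equation [iota_xi Omega = d mu], multiplied by [i].  The coefficient
    [- 1/2] is the product of [i] with the factor [i/2] of [Omega]. *)
Lemma contract_omega_moment p : D p ->
  'i *: differential (moment L) p = \sum_a \sum_b
    ((- 2^-1 * c a b p) *: (evalv (covector_dz R a) (X p) *: covector_dzbar R b
                         - evalv (covector_dzbar R b) (X p) *: covector_dz R a)).
Proof.
move=> Dp.
have -> : 'i *: differential (moment L) p =
    \sum_b ('i * wirt_bar b (moment L) p) *: covector_dzbar R b +
    \sum_a ('i * wirt a (moment L) p) *: covector_dz R a.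
  rewrite differentialE scaler_sumr -big_split; apply: eq_bigr => a _ /=.
  by rewrite scalerDr !scalerA addrC.
have -> : \sum_a \sum_b
    ((- 2^-1 * c a b p) *: (evalv (covector_dz R a) (X p) *: covector_dzbar R b
                         - evalv (covector_dzbar R b) (X p) *: covector_dz R a)) =
    \sum_b (\sum_a (- 2^-1 * c a b p) * evalv (covector_dz R a) (X p)) *: covector_dzbar R b +
    \sum_a (\sum_b (- 2^-1 * c a b p) * - evalv (covector_dzbar R b) (X p)) *: covector_dz R a.
  under [X in _ = X + _]eq_bigr => b _ do rewrite scaler_suml.
  rewrite [X in _ = X + _]exchange_big -big_split; apply: eq_bigr => a _ /=.
  rewrite scaler_suml -big_split; apply: eq_bigr => b _ /=.
  by rewrite scalerBr !scalerA mulrN scaleNr.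
congr (_ + _); apply: eq_bigr => a _; congr (_ *: _).
  rewrite (wirt_bar_moment oD L_smooth a Dp) big_split_ord /=.
  rewrite [X in _ = X + _]big1 ?add0r; last first.
    by move=> b _; rewrite (evalv_rotate_w p b) mulr0.
  rewrite !mulr_sumr; apply: eq_bigr => j _; rewrite evalv_rotate_z -/(c _ _ _).
  move: (c _ _ _) => u; ring.
rewrite (wirt_moment oD L_smooth L_rot a Dp) big_split_ord /=.
  rewrite [X in _ = X + _]big1 ?add0r; last first.
  by move=> b _; rewrite evalv_rotate_w oppr0 mulr0.
rewrite !mulr_sumr; apply: eq_bigr => j _; rewrite evalv_rotate_z -/(c _ _ _).
move: (c _ _ _) => u; ring.
Qed.

(** [contract_exp] with [omega = i Omega] handles the exponential, and the
    covectors [dw_j] vanish on the fundamental field, which only rotates the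
    [z]-coordinates. *)
Lemma annihilator_moment p : D p ->
  annihilator (wedge (\big[@wedge R _/ext_scalar _ 1]_(j < m) dz R (lshift n j))
      (ext_exp ('i *: (('i / 2) *: del (delbar (fun_form f)) p))))
    (X p, - ('i *: differential (moment L) p)).
Proof.
move=> Dp; rewrite /annihilator /=.
rewrite (eq_bigr _ (fun (j : 'I_m) _ => dzE R (lshift n j))).
apply: clifford_wedge_big => [j|]; first by rewrite /= evalv_rotate_w.
have -> : 'i *: (('i / 2) *: del (delbar (fun_form f)) p) =
    \sum_a wedge (ext_covector (covector_dz R a))
      (\sum_b (- 2^-1 * c a b p) *: ext_covector (covector_dzbar R b)).
  rewrite (del_delbar_fun_form Dp) scalerA mulrA -expr2 sqrCi mulN1r scaler_sumr.
  apply: eq_bigr => a _; rewrite -wedgeZr scaler_sumr; congr wedge.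
  by apply: eq_bigr => b _; rewrite scalerA.
rewrite /clifford /= (contract_exp (contract_omega_moment Dp)).
rewrite -wedgeDl -ext_covectorD subrr -(scale0r (0 : 'rV[C R]_(m + n + (m + n)))).
by rewrite ext_covectorZ scale0r wedge0l.
Qed.

End Annihilator.

Theorem theorem3p3p1 (R : realType) (m n : nat)
  (D : set 'rV[C R]_(m + n))
  (hD : bounded_reinhardt_domain D)
  (Kw : 'rV[C R]_m -> 'rV[C R]_n -> 'rV[C R]_n -> C R)
  (hKw : forall w, slice D w !=set0 -> is_bergman_kernel (slice D w) (Kw w))
  (K : 'rV[C R]_(m + n) -> R)
  (hK : forall w z, slice D w z -> ofR (K (row_mx w z)) = Kw w z z)
  (hKsmooth : smooth_on D (fun p => ofR (K p)))
  (hphi : generalized_calabi_yau D (bergman_spinor K))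
  (hact : preserves_form D (@rotate_z R m n) (bergman_spinor K)) :
  generalized_moment_map D (bergman_spinor K) (@rotate_z R m n)
    (bergman_moment K).
Proof.
have [_ oD _ _ _] := hD.
have D_rot t p : D p -> D (rotate_last t p) by exact: rotate_last_in.
pose L p : R := ln (K p).
have L_smooth r : Cr_on r D (fun q => ofR (L q)).
  by apply: (Cr_on_ln oD (kernel_gt0 hD hKw hK)); exact: hKsmooth.
have L_rot t p : D p -> L (rotate_last t p) = L p.
  by move=> Dp; rewrite /L (kernel_rotate_last hD hKw hK).
have muE : bergman_moment K = moment L by [].
rewrite muE; split.
- by move=> p Dp; rewrite (moment_real oD L_smooth L_rot Dp).
- by move=> r; exact: Cr_on_moment.
- by move=> theta p Dp; exact: (moment_rotate oD D_rot L_smooth L_rot).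
- by move=> p Dp; exact: (annihilator_moment oD L_smooth L_rot Dp).
Qed.
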